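(* (a) The map $\Phi:\mathfrak{X}/K\to\mathfrak{E}/K$, $\mathbb{O}\mapsto\mathfrak{O}_{\overline{T^*_{\mathbb{O}}\mathfrak{X}}}$, is a surjection whose fibers have at most two elements. (b) In the case where $p\leq\max\{k,n-k,q+1\}$, the map $\Phi$ is bijective.
   Context: Everything is over $\mathbb{C}$. Let $V=\mathbb{C}^n$ ($n\ge 1$), $p+q=n$, $V_1=\mathbb{C}^p\times\{0\}^q$, $V_2=\{0\}^p\times\mathbb{C}^q$, so $V=V_1\oplus V_2$. Let $G=\mathrm{GL}(V)$ and $K=\mathrm{GL}(V_1)\times\mathrm{GL}(V_2)\subset G$. Let $k\in\{0,\ldots,n\}$; $\mathrm{Gr}_k(V)$ is the Grassmann variety of $k$-dimensional subspaces of $V$ and $\mathbb{P}(V_1)$ is the variety of lines $L\subset V_1$. The exotic Grassmannian is $\mathfrak{X}=\mathrm{Gr}_k(V)\times\mathbb{P}(V_1)$ with the diagonal action of $K$. $\mathcal{L}(V)$ is the space of linear endomorphisms of $V$. For $x=\begin{pmatrix} x_1 & x_{12} \\ x_{21} & x_2 \end{pmatrix}\in\mathcal{L}(V)$ (blocks with respect to $V=V_1\oplus V_2$) put $x^{\theta}=\begin{pmatrix} x_1 & 0 \\ 0 & x_2 \end{pmatrix}$ and $x^{-\theta}=\begin{pmatrix} 0 & x_{12} \\ x_{21} & 0 \end{pmatrix}$. Let $\mathfrak{s}=\{x\in\mathcal{L}(V): x^\theta=0\}$. The conormal variety is $$\mathcal{Y}=\{(W,L,x)\in\mathrm{Gr}_k(V)\times\mathbb{P}(V_1)\times\mathcal{L}(V):\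 \mathrm{Im}\,x\subset W\subset\ker x,\ \mathrm{Im}\,x^\theta\subset L\subset\ker x^\theta\},$$ and the exotic nilpotent cone is $\mathfrak{E}=\mathbb{P}(V_1)\times\mathcal{N}(\mathfrak{s})_2^k$, where $\mathcal{N}(\mathfrak{s})_2^k=\{x\in\mathfrak{s}: x^2=0,\ \mathrm{rk}\,x\le\min\{k,n-k\}\}$. The map $\pi:\mathcal{Y}\to\mathfrak{E}$, $(W,L,x)\mapsto(L,x^{-\theta})$, is well defined and surjective. $K$ acts on $\mathcal{L}(V)$ by conjugation and diagonally on $\mathcal{Y}$ and $\mathfrak{E}$; $\pi$ is $K$-equivariant. $\mathfrak{X}/K$ and $\mathfrak{E}/K$ are the (finite) sets of $K$-orbits. For a $K$-orbit $\mathbb{O}\subset\mathfrak{X}$, the conormal bundle $T^*_{\mathbb{O}}\mathfrak{X}$ (a subvariety of $T^*\mathfrak{X}$) is identified with $\{(W,L,x)\in\mathcal{Y}:(W,L)\in\mathbb{O}\}$. Its closures $\overline{T^*_{\mathbb{O}}\mathfrak{X}}$, $\mathbb{O}\in\mathfrak{X}/K$, are exactly the irreducible components of $\mathcal{Y}$, and $\mathbb{O}\mapsto\overline{T^*_{\mathbb{O}}\mathfrak{X}}$ is a bijection $\mathfrak{X}/K\to\mathrm{Irr}(\mathcal{Y})$. For an irreducible component $\mathcal{C}$ of $\mathcal{Y}$, $\mathfrak{O}_{\mathcal{C}}$ denotes the unique $K$-orbit of $\mathfrak{E}$ such that $\mathcal{C}\subset\overline{\pi^{-1}(\mathfrak{O}_{\mathcal{C}})}$.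 *)

(* Defs.v *)
From HB Require Import structures.
From mathcomp Require Import all_boot all_order all_algebra.
From mathcomp Require Import boolp classical_sets functions cardinality reals.
From mathcomp Require Import complex.
From mathcomp Require mpoly.

Set Implicit Arguments.
Unset Strict Implicit.
Unset Printing Implicit Defensive.

Import GRing.Theory.
Local Open Scope classical_set_scope.
Local Open Scope ring_scope.

(* The ground field is the field of complex numbers R[i], with R any model of
   the real numbers; V is the space of column vectors 'cV_(p + q), on which
   matrices act from the left.  Varieties are sets of points in ambient types
   of arbitrary subspaces and matrices. *)
Section ExoticGrassmannian.
Variables (R : realType) (p q k : nat).

Local Notation C := (R[i]).
Local Notation n := (p + q)%N.
Local Notation V := 'cV[C]_n.

Definition lmul m (A : 'M[C]_(n, m)) : 'Hom('cV[C]_m, V) := linfun (mulmx A).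

Definition V1 : {vspace V} := limg (lmul (col_mx (1%:M : 'M[C]_p) 0)).

Definition Gr : set {vspace V} := [set W | \dim W = k].

Definition PV1 : set {vspace V} := [set L | \dim L = 1%N /\ (L <= V1)%VS].

Definition Xpt : Type := ({vspace V} * {vspace V})%type.
Definition Ypt : Type := ({vspace V} * {vspace V} * 'M[C]_n)%type.
Definition Ept : Type := ({vspace V} * 'M[C]_n)%type.

Definition exotic_grassmannian : set Xpt := Gr `*` PV1.

Definition theta (x : 'M[C]_n) : 'M[C]_n :=
  block_mx (ulsubmx x) 0 0 (drsubmx x).
Definition mtheta (x : 'M[C]_n) : 'M[C]_n :=
  block_mx 0 (ursubmx x) (dlsubmx x) 0.

Definition conormal_variety : set Ypt :=
  [set y | let: (W, L, x) := y in
    [/\ Gr W, PV1 L,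
        (limg (lmul x) <= W)%VS /\ (W <= lker (lmul x))%VS &
        (limg (lmul (theta x)) <= L)%VS /\ (L <= lker (lmul (theta x)))%VS]].

Definition nilcone : set 'M[C]_n :=
  [set x | [/\ theta x = 0, x *m x = 0 & (\rank x <= minn k (n - k))%N]].

Definition exotic_nilcone : set Ept := PV1 `*` nilcone.

Definition pi_map (y : Ypt) : Ept := let: (W, L, x) := y in (L, mtheta x).

Definition Kgroup : set 'M[C]_n :=
  [set g | exists g1 : 'M[C]_p, exists g2 : 'M[C]_q,
    [/\ g1 \in unitmx, g2 \in unitmx & g = block_mx g1 0 0 g2]].

Definition actX (g : 'M[C]_n) (w : Xpt) : Xpt :=
  ((lmul g @: w.1)%VS, (lmul g @: w.2)%VS).
Definition actE (g : 'M[C]_n) (e : Ept) : Ept :=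
  ((lmul g @: e.1)%VS, g *m e.2 *m invmx g).

Definition orbitsX : set (set Xpt) :=
  [set O | exists2 w, exotic_grassmannian w & O = [set actX g w | g in Kgroup]].
Definition orbitsE : set (set Ept) :=
  [set O | exists2 e, exotic_nilcone e & O = [set actE g e | g in Kgroup]].

(* Zariski topology on Gr_k(V) x P(V_1) x L(V).  A subspace W in Gr_k(V) is the
   column space of an n x k matrix A of rank k, and a line in P(V_1) is spanned
   by some nonzero v in C^p, embedded in V by appending zeros.  The map
   (A, v, x) |-> (im A, <v>, x) is a Zariski-locally trivial
   (GL_k x GL_1)-bundle, so the topology on the target is the quotient
   topology: a set is closed iff its preimage is the zero locus of a family of
   polynomials in the entries of (A, v, x). *)
Definition coords (A : 'M[C]_(n, k)) (v : 'cV[C]_p) (x : 'M[C]_n) :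
    'I_(n * k + p + n * n) -> C :=
  fun i => row_mx (row_mx (mxvec A) v^T) (mxvec x) 0 i.

Definition zclosed (Z : set Ypt) : Prop :=
  Z `<=` Gr `*` PV1 `*` setT /\
  exists F : set (mpoly.mpoly (n * k + p + n * n) C),
    forall (A : 'M[C]_(n, k)) (v : 'cV[C]_p) (x : 'M[C]_n),
      \rank A = k -> v != 0 ->
      Z (limg (lmul A), <[col_mx v 0]>%VS, x) <->
      (forall f, F f -> mpoly.meval (coords A v x) f = 0).

Definition zclosure (S : set Ypt) : set Ypt := smallest zclosed S.

Definition conormal_bundle (O : set Xpt) : set Ypt :=
  [set y | conormal_variety y /\ O y.1].

Definition pi_preimage (O : set Ept) : set Ypt :=
  conormal_variety `&` pi_map @^-1` O.

(* The unique orbit whose preimage has a closure containing Z; the empty set,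
   which is not an orbit, if there is no such orbit or more than one. *)
Definition orbit_of_component (Z : set Ypt) : set Ept :=
  xget set0 [set O | unique
    (fun O' => orbitsE O' /\ Z `<=` zclosure (pi_preimage O')) O].

Definition Phi (O : set Xpt) : set Ept :=
  orbit_of_component (zclosure (conormal_bundle O)).

End ExoticGrassmannian.

Arguments orbitsX R p q k : clear implicits.
Arguments orbitsE R p q k : clear implicits.
Arguments Phi R p q k : clear implicits.

(* Main.v *)
Require Import Defs.
From mathcomp Require Import all_boot all_order all_algebra.
From mathcomp Require Import fingroup perm zify.
From mathcomp Require Import boolp classical_sets functions cardinality reals.
From mathcomp Require Import complex.
From mathcomp Require mpoly.
Import (canonicals) mpoly.

(* Transposing, W is the row space of a k x n matrix [A1 A2] of rank k, L is
   spanned by a row v, and x^T = [X1 Y; Z 0].  The K-orbit of (W, L) is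
   determined by r1 = rk A1, r2 = rk A2 and the position of v (in the row space
   of [A1 A2], of A1 only, or of neither); the K-orbit of (L, x^{-theta}) by
   s = rk Z, t = rk Y and the position of v (in im Z, in ker Y only, or
   neither).  The fiber of the conormal bundle over (W, L) is a vector space, on
   a dense open subset of which (s, t, position) takes the value phi (r1, r2,
   position); every point is a limit of such generic points along a line in its
   fiber.  Conversely, the preimage of an orbit of the exotic nilpotent cone
   satisfies rank inequalities in (A, v, x).  These are closed conditions, and
   the generic points of a conormal bundle satisfy them for a single orbit, the
   one given by phi.  The rest is the arithmetic of phi: two orbits can only have
   the same image if L is contained in W for exactly one of them, and if
   q < k < p. *)

Set Implicit Arguments.
Unset Strict Implicit.
Unset Printing Implicit Defensive.

Import Order.TTheory GRing.Theory Num.Theory.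
Local Open Scope classical_set_scope.
Local Open Scope ring_scope.

(** * Classification of the orbits *)

(** Dictionary: [kermx A1] and [kermx A2] are W ∩ V2 and W ∩ V1 in the coordinates of W, of
    dimensions k - r1 and k - r2, and the row space of [kermx A2 *m A1] is W ∩ V1 itself. Hence r1 +
    r2 >= k, with equality iff W splits, i.e. W = (W ∩ V1) + (W ∩ V2). If X1 vanished, Y and Z would
    vary independently, with generic ranks min(k, p) - r1 and min(k, q) - r2. The block X1 has rank
    at most 1 and is the source of every [.+1] in [phi]. If L is in W and W does not split, A2 Z = -
    A1 X1 may be nonzero, and the bound q on rk Z + r2 grows by one. If L is only in the projection
    of W, the rows of Y may leave W ∩ V2 in one further direction, and the bound k on rk Y + r1
    grows by one. The delicate case is a split W containing L: there L lies in the row space of a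
    generic Z iff Z can fill W ∩ V1, that is, iff k <= q. *)

Section LinearAlgebra.
Variable F : fieldType.
Implicit Types m n p q k : nat.

(** The rows of [1 - M *m pinvmx M] lie in the kernel of [M], hence are killed by [N]. *)
Lemma mulmx_ker_extend m p n (M : 'M[F]_(m, p)) (N : 'M_(m, n)) :
  kermx M *m N = 0 -> exists D, N = M *m D.
Proof.
move=> kN; exists (pinvmx M *m N).
have: ((1%:M - M *m pinvmx M) <= kermx M)%MS.
  by rewrite sub_kermx mulmxBl mul1mx mulmxKpV ?submx_refl// subrr.
case/submxP=> D eqD; apply/eqP; rewrite mulmxA -subr_eq0.
by rewrite -{1}[N]mul1mx -mulmxBl eqD -mulmxA kN mulmx0.
Qed.

(** The factor [D] with [M' = M *m D] keeps the rank of [M], so it is injective on the row space of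
    [M] and may be replaced there by an invertible matrix. *)
Lemma unitmx_extend m p (M M' : 'M[F]_(m, p)) :
  kermx M *m M' = 0 -> \rank M = \rank M' ->
  exists2 G, G \in unitmx & M *m G = M'.
Proof.
case/mulmx_ker_extend=> D -> eq_rk.
by have [G Gu ->] := complete_unitmx (esym eq_rk); exists G.
Qed.

Lemma unitmx_extend_free m p (M M' : 'M[F]_(m, p)) :
  row_free M -> row_free M' -> exists2 G, G \in unitmx & M *m G = M'.
Proof.
move=> fM fM'; apply: unitmx_extend; last by rewrite (eqP fM) (eqP fM').
by move: (kermx_eq0 M); rewrite fM => /eqP->; rewrite mul0mx.
Qed.

(* e1 m *m B is the first row of B; m = 0 is allowed. *)
Definition e1 m : 'rV[F]_m := \row_(j < m) (j == 0 :> nat)%:R.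

Lemma rank_col_mx_notin m n (A : 'M[F]_(m, n)) (v : 'rV_n) :
  ~~ (v <= A)%MS -> \rank (col_mx A v) = (\rank A).+1.
Proof.
move=> vA; have v0 : v != 0 by apply: contraNneq vA => ->; rewrite sub0mx.
rewrite -addsmxE mxrank_disjoint_sum ?rank_rV ?v0 ?addn1 //.
apply/eqP/rowV0P=> y; rewrite sub_capmx => /andP[yA /sub_rVP[c yE]].
have [c0|c0] := eqVneq c 0; first by rewrite yE c0 scale0r.
by case/negP: vA; rewrite -(eqmx_scale v c0) -yE.
Qed.

Lemma kermx_mul0P m n p (M : 'M[F]_(m, p)) (N : 'M_(m, n)) :
  (forall x : 'rV_m, x *m M = 0 -> x *m N = 0) -> kermx M *m N = 0.
Proof.
move=> H; apply/row_matrixP=> i; rewrite row_mul row0 H //.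
by rewrite -row_mul mulmx_ker row0.
Qed.

Lemma e1_col_mx m n (u : 'rV[F]_n) (B : 'M_(m, n)) :
  e1 m.+1 *m (col_mx u B : 'M_(m.+1, n)) = u.
Proof.
have -> : e1 m.+1 = (row_mx 1%:M 0 : 'rV_(1 + m)).
  apply/rowP=> j; rewrite !mxE; case: (@splitP 1 m j) => i ->.
    by rewrite !ord1 !mxE.
  by rewrite !mxE.
by rewrite [LHS](@mul_row_col _ 1 1 m) mul1mx mul0mx addr0.
Qed.

(** Orbits are compared by matching bases row by row. Having [u] as the first new row makes the
    matching carry the line L along. *)
Lemma basis_between m0 m1 n m (S : 'M[F]_(m0, n)) (T : 'M_(m1, n)) u :
    (S <= T)%MS -> \rank T = (\rank S + m)%N -> (u <= T)%MS ->
  exists B : 'M_(m, n),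
    (S + B :=: T)%MS /\ (~~ (u <= S)%MS -> e1 m *m B = u).
Proof.
have gen m2 l (S' : 'M[F]_(m2, n)) : (S' <= T)%MS ->
    \rank T = (\rank S' + l)%N -> exists B : 'M_(l, n), (S' + B :=: T)%MS.
  move=> sST rkT; have := mxrank_cap_compl T S'.
  rewrite (capmx_idPr sST) rkT => /addnI <-.
  exists (row_base (T :\: S')%MS).
  apply: eqmx_trans (adds_eqmx (eqmx_refl _) (eq_row_base _)) _.
  rewrite addsmxC; apply: eqmx_trans (addsmx_diff_cap_eq T S').
  by apply: adds_eqmx => //; apply/eqmx_sym/capmx_idPr.
move=> sST rkT uT; case: (boolP (u <= S)%MS) => [uS | uS].
  by have [B eB] := gen _ _ _ sST rkT; exists B.
have rkSu : \rank (S + u)%MS = (\rank S + 1)%N.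
  by rewrite addsmxE rank_col_mx_notin // addn1.
have sSuT : (S + u <= T)%MS by rewrite addsmx_sub sST.
case: m => [|m] in rkT *.
  by have := mxrankS sSuT; rewrite rkSu rkT; lia.
have rkT' : \rank T = (\rank (S + u)%MS + m)%N by rewrite rkSu rkT; lia.
have [B eB] := gen _ _ _ sSuT rkT'.
exists (col_mx u B : 'M_(m.+1, n)); split; last by rewrite e1_col_mx.
apply: eqmx_trans eB; apply: eqmx_trans (adds_eqmx (eqmx_refl S) (eqmx_sym (addsmxE u B))) _.
by rewrite addsmxA.
Qed.

Lemma row_free_col_mx m1 m2 n (A : 'M[F]_(m1, n)) (B : 'M_(m2, n)) :
  \rank (A + B)%MS = (m1 + m2)%N -> row_free (col_mx A B).
Proof. by rewrite addsmxE /row_free => ->. Qed.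

Lemma basis_of m0 n m (N : 'M[F]_(m0, n)) (u : 'rV_n) :
    \rank N = m -> (u <= N)%MS ->
  exists B : 'M_(m, n), (B :=: N)%MS /\ (u != 0 -> e1 m *m B = u).
Proof.
move=> rN uN; have rN0 : \rank N = (\rank (0%R : 'M[F]_n) + m)%N by rewrite mxrank0.
have [B [eB uB]] := basis_between (sub0mx n N) rN0 uN.
exists B; split=> [|u0]; last by rewrite uB // submx0.
exact: eqmx_trans (eqmx_sym (adds0mx n B)) eB.
Qed.

(** To be applied with the kernels of [A1] and [A2] as [N1] and [N2], and with [u] the coordinates
    of v. Since [u] matters only modulo [N1], the cases are: L in W, L in the projection of W only,
    and (with [u = 0]) no condition on L. *)
Lemma two_subspaces_transitive k (N1 N2 N1' N2' : 'M[F]_k) (u u' : 'rV_k) :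
    (N1 :&: N2 = 0)%MS -> (N1' :&: N2' = 0)%MS ->
    \rank N1 = \rank N1' -> \rank N2 = \rank N2' ->
    [\/ [/\ u <= N2, u' <= N2', u != 0 & u' != 0]%MS,
        ~~ (u <= N1 + N2)%MS /\ ~~ (u' <= N1' + N2')%MS |
        u = 0 /\ u' = 0] ->
  exists E, [/\ E \in unitmx, (N1 *m E :=: N1')%MS, (N2 *m E :=: N2')%MS &
    u *m E = u'].
Proof.
move=> dN dN' r1 r2 H.
(* The default 0 lets one choice of bases serve all three cases; the first row of [B2] is [u] only
   when [u] is a nonzero vector of [N2]. *)
pose w := if (u <= N2)%MS then u else 0.
pose w' := if (u' <= N2')%MS then u' else 0.
have wN : (w <= N2)%MS by rewrite /w; case: ifP => // _; rewrite sub0mx.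
have wN' : (w' <= N2')%MS by rewrite /w'; case: ifP => // _; rewrite sub0mx.
have [B1 [eB1 _]] := basis_of (erefl (\rank N1)) (sub0mx 1 N1).
have [B1' [eB1' _]] := basis_of (esym r1) (sub0mx 1 N1').
have [B2 [eB2 w2]] := basis_of (erefl (\rank N2)) wN.
have [B2' [eB2' w2']] := basis_of (esym r2) wN'.
have fB : \rank (B1 + B2)%MS = (\rank N1 + \rank N2)%N.
  by rewrite (adds_eqmx eB1 eB2) mxrank_disjoint_sum.
have fB' : \rank (B1' + B2')%MS = (\rank N1 + \rank N2)%N.
  by rewrite (adds_eqmx eB1' eB2') mxrank_disjoint_sum // -r1 -r2.
have conclude E : E \in unitmx -> B1 *m E = B1' -> B2 *m E = B2' ->
    u *m E = u' -> exists E, [/\ E \in unitmx, (N1 *m E :=: N1')%MS,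
      (N2 *m E :=: N2')%MS & u *m E = u'].
  move=> Eu E1 E2 uE; exists E; split=> //.
    by apply: eqmx_trans (eqmxMr _ (eqmx_sym eB1)) _; rewrite E1.
  by apply: eqmx_trans (eqmxMr _ (eqmx_sym eB2)) _; rewrite E2.
case: H => [[uN uN' u0 u0']|[uN uN']|[u0 u0']].
- have [E Eu] := unitmx_extend_free (row_free_col_mx fB) (row_free_col_mx fB').
  rewrite mul_col_mx => /eq_col_mx[E1 E2]; apply: (conclude E) => //.
  have eu : w = u by rewrite /w uN.
  have eu' : w' = u' by rewrite /w' uN'.
  by rewrite -eu -eu' -w2 ?eu // -w2' ?eu' // -mulmxA E2.
- have free1 (M1 : 'M[F]_(\rank N1, k)) (M2 : 'M[F]_(\rank N2, k)) (x : 'rV_k) :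
      \rank (M1 + M2)%MS = (\rank N1 + \rank N2)%N -> ~~ (x <= M1 + M2)%MS ->
      row_free (col_mx (col_mx M1 M2) x).
    move=> rM xM; rewrite addsmxE in rM xM.
    rewrite /row_free rank_col_mx_notin; first by rewrite rM addn1.
    by rewrite -addsmxE.
  have nu : ~~ (u <= B1 + B2)%MS by rewrite (adds_eqmx eB1 eB2).
  have nu' : ~~ (u' <= B1' + B2')%MS by rewrite (adds_eqmx eB1' eB2').
  have [E Eu] := unitmx_extend_free (free1 _ _ _ fB nu) (free1 _ _ _ fB' nu').
  rewrite !mul_col_mx => /eq_col_mx[/eq_col_mx[E1 E2] uE].
  exact: (conclude E).
- have [E Eu] := unitmx_extend_free (row_free_col_mx fB) (row_free_col_mx fB').
  rewrite mul_col_mx => /eq_col_mx[E1 E2]; apply: (conclude E) => //.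
  by rewrite u0 u0' mul0mx.
Qed.

Lemma kermx_cap_row_free k p q (A1 : 'M[F]_(k, p)) (A2 : 'M_(k, q)) :
  row_free (row_mx A1 A2) -> (kermx A1 :&: kermx A2 = 0)%MS.
Proof.
move=> fA; apply/eqP/rowV0P=> x; rewrite sub_capmx !sub_kermx.
case/andP=> /eqP x1 /eqP x2; apply/eqP.
by rewrite -(mulmx_free_eq0 _ fA) mul_mx_row x1 x2 row_mx0.
Qed.

Lemma kermx_unit_eq k p (A A' : 'M[F]_(k, p)) (E : 'M_k) :
    E \in unitmx -> (kermx A *m E :=: kermx A')%MS ->
  kermx A *m (E *m A') = 0 /\ \rank A = \rank (E *m A').
Proof.
move=> Eu eE; split.
  by apply/eqP; rewrite mulmxA -sub_kermx eE.
rewrite (eqmxMfull A'); last by rewrite row_full_unit.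
have := mxrank_ker A'; rewrite -eE mxrankMfree ?row_free_unit // mxrank_ker.
have := rank_leq_row A; have := rank_leq_row A'; lia.
Qed.

(** A change of basis [E] of W that matches both kernels is enough for the blocks: [A1] and
    [E *m A1'] then differ by some [G1], and [A2] and [E *m A2'] by some [G2]. Only v constrains
    [E], and only if v = u A1; otherwise [G1] can be prescribed on v as well. *)
Theorem exotic_grassmannian_classification k p q
    (A1 A1' : 'M[F]_(k, p)) (A2 A2' : 'M_(k, q)) (v v' : 'rV_p) :
    row_free (row_mx A1 A2) -> row_free (row_mx A1' A2') -> v != 0 -> v' != 0 ->
    \rank A1 = \rank A1' -> \rank A2 = \rank A2' ->
    (row_mx v 0 <= row_mx A1 A2)%MS = (row_mx v' 0 <= row_mx A1' A2')%MS ->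
    (v <= A1)%MS = (v' <= A1')%MS ->
  exists E G1 G2, [/\ E \in unitmx, G1 \in unitmx & G2 \in unitmx] /\
    [/\ A1 *m G1 = E *m A1', A2 *m G2 = E *m A2' & v *m G1 = v'].
Proof.
move=> fA fA' v0 v0' r1 r2 c1 c2.
have d := kermx_cap_row_free fA; have d' := kermx_cap_row_free fA'.
have rN1 : \rank (kermx A1) = \rank (kermx A1') by rewrite !mxrank_ker r1.
have rN2 : \rank (kermx A2) = \rank (kermx A2') by rewrite !mxrank_ker r2.
have finish E (G1 : 'M_p) : E \in unitmx -> G1 \in unitmx ->
    A1 *m G1 = E *m A1' -> v *m G1 = v' ->
    (kermx A2 *m E :=: kermx A2')%MS ->
    exists E G1 G2, [/\ E \in unitmx, G1 \in unitmx & G2 \in unitmx] /\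
    [/\ A1 *m G1 = E *m A1', A2 *m G2 = E *m A2' & v *m G1 = v'].
  move=> Eu G1u eA1 ev /(kermx_unit_eq Eu)[k2 rk2].
  by have [G2 G2u eG2] := unitmx_extend k2 rk2; exists E, G1, G2.
have [c2t|c2f] := boolP (v <= A1)%MS; last first.
  have [E [Eu e1 e2 _]] := two_subspaces_transitive d d' rN1 rN2
     (Or33 _ _ (conj (erefl (0 : 'rV_k)) (erefl 0))).
  have [k1 rk1] := kermx_unit_eq Eu e1.
  have c2f' : ~~ (v' <= E *m A1')%MS.
    by rewrite (eqmxMfull A1') ?row_full_unit // -c2.
  have [G1 G1u] :
      exists2 G1, G1 \in unitmx & col_mx A1 v *m G1 = col_mx (E *m A1') v'.
    apply: unitmx_extend; last by rewrite !rank_col_mx_notin // rk1.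
    apply: kermx_mul0P => x; rewrite -[x]hsubmxK !mul_row_col.
    rewrite [rsubmx x]mx11_scalar !mul_scalar_mx; set c := _ 0 0.
    have [->|c0] := eqVneq c 0.
      rewrite !scale0r !addr0 => /eqP; rewrite -sub_kermx => /submxP[y ->].
      by rewrite -mulmxA k1 mulmx0.
    move=> /eqP; rewrite addrC addr_eq0 => /eqP eq0; case/negP: c2f.
    by rewrite -(eqmx_scale v c0) eq0 eqmx_opp submxMl.
  by rewrite mul_col_mx => /eq_col_mx[eA1 ev]; apply: (finish E G1).
(* If L is in W, the coordinates of (v, 0) in W give a [u] killed by [A2]. Otherwise any [u] works:
   if it were in the sum of the kernels, removing its part in [kermx A1] would put (v, 0) in W. *)
have [u [u' [eu eu' cu]]] : exists u u' : 'rV_k, [/\ v = u *m A1, v' = u' *m A1' &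
    [\/ [/\ u <= kermx A2, u' <= kermx A2', u != 0 & u' != 0]%MS,
        ~~ (u <= kermx A1 + kermx A2)%MS /\ ~~ (u' <= kermx A1' + kermx A2')%MS |
        u = 0 /\ u' = 0]].
  have nz (A : 'M[F]_(k, p)) w x : w = x *m A -> w != 0 -> x != 0.
    by move=> -> ; apply: contra_neq => ->; rewrite mul0mx.
  have [c1t|c1f] := boolP (row_mx v 0 <= row_mx A1 A2)%MS.
    have c1t' := c1t; rewrite c1 in c1t'.
    have {c1t} [u] := submxP c1t; have {c1t'} [u'] := submxP c1t'.
    rewrite !mul_mx_row => /eq_row_mx[eu' z'] /eq_row_mx[eu z].
    exists u, u'; split=> //; constructor 1; rewrite !sub_kermx -z -z' eqxx.
    by rewrite (nz _ _ _ _ eu) ?(nz _ _ _ _ eu').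
  have c1f' := c1f; rewrite c1 in c1f'; have c2t' := c2t; rewrite c2 in c2t'.
  have [u eu] := submxP c2t; have [u' eu'] := submxP c2t'.
  exists u, u'; split=> //; constructor 2.
  have nin (B1 : 'M[F]_(k, p)) (B2 : 'M_(k, q)) w x : w = x *m B1 ->
      ~~ (row_mx w 0 <= row_mx B1 B2)%MS -> ~~ (x <= kermx B1 + kermx B2)%MS.
    move=> ->; apply: contra => /sub_addsmxP[y ->].
    rewrite mulmxDl -mulmxA mulmx_ker mulmx0 add0r.
    suff -> : row_mx (y.2 *m kermx B2 *m B1) 0
        = y.2 *m kermx B2 *m row_mx B1 B2 by rewrite submxMl.
    by rewrite mul_mx_row -[_ *m B2]mulmxA mulmx_ker mulmx0.
  by split; [apply: nin c1f|apply: nin c1f'].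
have [E [Eu e1 e2 uE]] := two_subspaces_transitive d d' rN1 rN2 cu.
have [k1 rk1] := kermx_unit_eq Eu e1.
have [G1 G1u eG1] := unitmx_extend k1 rk1.
by apply: (finish E G1) => //; rewrite eu eu' -mulmxA eG1 mulmxA uE.
Qed.

Lemma rank_col_mx3 n m1 m2 m3 m4 (S : 'M[F]_(m1, n)) (B : 'M_(m2, n))
    (T : 'M_(m3, n)) (C : 'M_(m4, n)) :
  (S + B :=: T)%MS -> (T + C :=: 1%:M)%MS -> \rank (col_mx (col_mx S B) C) = n.
Proof.
move=> eT e1; rewrite -addsmxE -[RHS](mxrank1 F n) -e1.
by rewrite (adds_eqmx (eqmx_trans (eqmx_sym (addsmxE S B)) eT) (eqmx_refl C)).
Qed.

(* V1 is split as im Z + H + C with im Z + H = ker Y, and V2 as im Y + H' + D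
   with im Y + H' = ker Z; then Y maps C isomorphically to im Y and Z maps D
   isomorphically to im Z. *)
Lemma nilcone_adapted_bases p q (Y : 'M[F]_(p, q)) (Z : 'M_(q, p)) (v : 'rV_p) :
    Y *m Z = 0 -> Z *m Y = 0 -> v != 0 ->
  exists (C : 'M_(\rank Y, p)) (H : 'M_(p - \rank Y - \rank Z, p))
    (D : 'M_(\rank Z, q)) (H' : 'M_(q - \rank Z - \rank Y, q)),
  [/\ \rank (col_mx (col_mx (D *m Z) H) C) = p /\ H *m Y = 0,
      \rank (col_mx (col_mx (C *m Y) H') D) = q /\ H' *m Z = 0,
      (v <= Z)%MS -> e1 _ *m D *m Z = v,
      ~~ (v <= Z)%MS && (v *m Y == 0) -> e1 _ *m H = v &
      v *m Y != 0 -> e1 _ *m C = v].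
Proof.
move=> YZ ZY v0.
have rYZ := mulmx0_rank_max YZ; have rZY := mulmx0_rank_max ZY.
have complement m n (M : 'M[F]_(m, n)) (x : 'rV_m) :
    exists B : 'M_(\rank M, m), [/\ (kermx M + B :=: 1%:M)%MS,
      (B *m M :=: M)%MS & x *m M != 0 -> e1 _ *m B = x].
  have r1 : \rank (1%:M : 'M[F]_m) = (\rank (kermx M) + \rank M)%N.
    by rewrite mxrank1 mxrank_ker subnK ?rank_leq_row.
  have [B [eB uB]] := basis_between (submx1 (kermx M)) r1 (submx1 x).
  exists B; split=> //; last by rewrite -sub_kermx.
  apply: eqmx_trans (_ : _ :=: (kermx M + B)%MS *m M)%MS _.
    apply: eqmx_sym; apply: eqmx_trans (addsmxMr _ _ _) _.
    by rewrite mulmx_ker; apply: adds0mx.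
  by apply: eqmx_trans (eqmxMr _ eB) _; rewrite mul1mx.
have [C [eC CY Cv]] := complement _ _ Y v.
have [d dv] : exists d, (v <= Z)%MS -> v = d *m Z.
  by case: (boolP (v <= Z)%MS) => [/submxP[d ->]|_]; [exists d|exists 0].
have [D [eD DZ Dd]] := complement _ _ Z d.
have sZ : (D *m Z <= kermx Y)%MS by rewrite sub_kermx -mulmxA ZY mulmx0.
have sY : (C *m Y <= kermx Z)%MS by rewrite sub_kermx -mulmxA YZ mulmx0.
have rkY : \rank (kermx Y) = (\rank (D *m Z) + (p - \rank Y - \rank Z))%N.
  by rewrite mxrank_ker DZ; lia.
have rkZ : \rank (kermx Z) = (\rank (C *m Y) + (q - \rank Z - \rank Y))%N.
  by rewrite mxrank_ker CY; lia.
pose w := if v *m Y == 0 then v else 0.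
have wY : (w <= kermx Y)%MS.
  by rewrite /w; case: ifP => [|_]; rewrite ?sub0mx // sub_kermx.
have [H [eH wH]] := basis_between sZ rkY wY.
have [H' [eH' _]] := basis_between sY rkZ (sub0mx 1 _).
exists C, H, D, H'; split=> //.
- split; first exact: rank_col_mx3 eH eC.
  by apply/eqP; rewrite -sub_kermx -eH addsmxSr.
- split; first exact: rank_col_mx3 eH' eD.
  by apply/eqP; rewrite -sub_kermx -eH' addsmxSr.
- by move=> vZ; rewrite Dd -?dv.
- by case/andP=> vZ vY; move: wH; rewrite /w vY DZ; apply.
Qed.

Theorem exotic_nilcone_classification p q
    (Y Y' : 'M[F]_(p, q)) (Z Z' : 'M_(q, p)) (v v' : 'rV_p) :
    Y *m Z = 0 -> Z *m Y = 0 -> Y' *m Z' = 0 -> Z' *m Y' = 0 ->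
    v != 0 -> v' != 0 ->
    \rank Y = \rank Y' -> \rank Z = \rank Z' ->
    (v <= Z)%MS = (v' <= Z')%MS -> (v *m Y == 0) = (v' *m Y' == 0) ->
  exists G1 G2, [/\ G1 \in unitmx & G2 \in unitmx] /\
    [/\ Y *m G2 = G1 *m Y', Z *m G1 = G2 *m Z' & v *m G1 = v'].
Proof.
move=> YZ ZY YZ' ZY' v0 v0' rY rZ c1 c2.
have := nilcone_adapted_bases YZ' ZY' v0'; rewrite -rY -rZ.
move=> [C' [H' [D' [K' [[b1' HY'] [b2' KZ'] I' II' III']]]]].
have [C [H [D [K [[b1 HY] [b2 KZ] I II III]]]]] := nilcone_adapted_bases YZ ZY v0.
have rYZ := mulmx0_rank_max YZ; have rZY := mulmx0_rank_max ZY.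
have [G1 G1u] : exists2 G1, G1 \in unitmx &
    col_mx (col_mx (D *m Z) H) C *m G1 = col_mx (col_mx (D' *m Z') H') C'.
  by apply: unitmx_extend_free; rewrite /row_free ?b1 ?b1'; apply/eqP; lia.
have [G2 G2u] : exists2 G2, G2 \in unitmx &
    col_mx (col_mx (C *m Y) K) D *m G2 = col_mx (col_mx (C' *m Y') K') D'.
  by apply: unitmx_extend_free; rewrite /row_free ?b2 ?b2'; apply/eqP; lia.
rewrite !mul_col_mx => /eq_col_mx[/eq_col_mx[eCY eK] eD].
move=> /eq_col_mx[/eq_col_mx[eDZ eH] eC].
exists G1, G2; split=> //; split.
(* Equality is tested on the adapted basis of V1: [Y] kills [D *m Z] and [H], and [C *m Y] belongs
   to the adapted basis of V2. *)
- apply: (row_full_inj (A := col_mx (col_mx (D *m Z) H) C)).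
    by rewrite /row_full b1.
  rewrite !mulmxA !mul_col_mx eDZ eH eC eCY HY HY' !mul0mx.
  by rewrite -[D *m Z *m Y]mulmxA -[D' *m Z' *m Y']mulmxA ZY ZY' !mulmx0 !mul0mx.
- apply: (row_full_inj (A := col_mx (col_mx (C *m Y) K) D)).
    by rewrite /row_full b2.
  rewrite !mulmxA !mul_col_mx eCY eK eD eDZ KZ KZ' !mul0mx.
  by rewrite -[C *m Y *m Z]mulmxA -[C' *m Y' *m Z']mulmxA YZ YZ' !mulmx0 !mul0mx.
- have [vZ|vZ] := boolP (v <= Z)%MS.
    by rewrite -(I vZ) -I' -?c1 // -!mulmxA [D *m _]mulmxA eDZ.
  have [vY|vY] := boolP (v *m Y == 0).
    by rewrite -(II _) ?vZ // -II' -?c1 -?c2 ?vZ // -mulmxA eH.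
  by rewrite -(III vY) -III' -?c2 // -mulmxA eC.
Qed.

End LinearAlgebra.

(** * Fibers of the conormal bundles *)

Section ConormalFiber.
Variables (F : fieldType) (p q k : nat).
Implicit Types (v : 'rV[F]_p) (Y : 'M[F]_(p, q)) (Z : 'M[F]_(q, p)).

(* 1: L in W;  2: L in the projection of W to V1 but not in W;  3: neither. *)
Definition xtype (A1 : 'M[F]_(k, p)) (A2 : 'M[F]_(k, q)) v : nat :=
  if (row_mx v 0 <= row_mx A1 A2)%MS then 1%N else if (v <= A1)%MS then 2%N else 3%N.

(* 1: L in im x_12;  2: L in ker x_21 but not in im x_12;  3: neither. *)
Definition etype Y Z v : nat :=
  if (v <= Z)%MS then 1%N else if v *m Y == 0 then 2%N else 3%N.

Lemma xtypeP (A1 : 'M[F]_(k, p)) (A2 : 'M[F]_(k, q)) v :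
  [\/ xtype A1 A2 v = 1%N, xtype A1 A2 v = 2%N | xtype A1 A2 v = 3%N].
Proof.
rewrite /xtype; case: ifP => _; first by constructor 1.
by case: ifP => _; [constructor 2|constructor 3].
Qed.

(* X is the transpose of x. *)
Definition conormal (A1 : 'M[F]_(k, p)) (A2 : 'M[F]_(k, q)) v (X : 'M[F]_(p + q)) : Prop :=
  [/\ drsubmx X = 0, (ulsubmx X <= v)%MS, v *m ulsubmx X = 0,
      row_mx A1 A2 *m X = 0 & (X <= row_mx A1 A2)%MS].

Lemma conormal_block A1 A2 v X1 Y Z :
  conormal A1 A2 v (block_mx X1 Y Z 0) <->
  [/\ (X1 <= v)%MS, v *m X1 = 0, A1 *m X1 + A2 *m Z = 0 /\ A1 *m Y = 0,
      (row_mx X1 Y <= row_mx A1 A2)%MS & (row_mx Z 0 <= row_mx A1 A2)%MS].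
Proof.
rewrite /conormal block_mxKul block_mxKdr mul_row_block mulmx0 addr0 block_mxEv.
rewrite col_mx_sub; split.
  move=> [_ ? ? e /andP[? ?]]; split=> //.
  by move: e; rewrite -row_mx0 => /eq_row_mx[].
by move=> [? ? [-> ->] -> ->]; split; rewrite ?row_mx0.
Qed.

Lemma rank_sum_ge (A1 : 'M[F]_(k, p)) (A2 : 'M[F]_(k, q)) :
  row_free (row_mx A1 A2) -> (k <= \rank A1 + \rank A2)%N.
Proof.
move=> fA; have := mxrank_disjoint_sum (kermx_cap_row_free fA).
rewrite !mxrank_ker => e; have := rank_leq_row (kermx A1 + kermx A2)%MS.
have := rank_leq_row A1; have := rank_leq_row A2; lia.
Qed.

(** The case where W is the sum of its intersections with V1 and V2. *)
Lemma kermx_add_full (A1 : 'M[F]_(k, p)) (A2 : 'M[F]_(k, q)) :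
    row_free (row_mx A1 A2) -> (k = \rank A1 + \rank A2)%N ->
  row_full (kermx A1 + kermx A2)%MS.
Proof.
move=> fA ek.
rewrite /row_full mxrank_disjoint_sum ?kermx_cap_row_free // !mxrank_ker.
have := rank_leq_row A1; have := rank_leq_row A2; lia.
Qed.

Lemma line_sub m n (x : 'rV[F]_n) (B : 'M_(m, n)) :
  (B <= x)%MS -> B != 0 -> (x <= B)%MS.
Proof.
move=> Bx B0; rewrite -(mxrank_leqif_sup Bx) eqn_leq mxrankS //= rank_rV.
by case: (x != 0); rewrite // lt0n mxrank_eq0.
Qed.

(** * Upper bounds valid on the whole conormal fiber *)

Section Bounds.
Variables (A1 : 'M[F]_(k, p)) (A2 : 'M[F]_(k, q)) (v : 'rV[F]_p).
Variables (X1 : 'M[F]_p) (Y : 'M[F]_(p, q)) (Z : 'M[F]_(q, p)).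
Hypothesis cX : conormal A1 A2 v (block_mx X1 Y Z 0).

Let r1 := \rank A1.
Let r2 := \rank A2.

Lemma conormal_sub_ker : exists2 D, Z = D *m A1 & (D <= kermx A2)%MS.
Proof.
have [_ _ _ _ /submxP[D]] := (conormal_block A1 A2 v X1 Y Z).1 cX.
rewrite mul_mx_row => /eq_row_mx[eZ e0].
by exists D => //; rewrite sub_kermx -e0.
Qed.

(** The rows of [Z] lie in W ∩ V1, of dimension k - r2. *)
Lemma conormal_rankZ : (\rank Z + r2 <= k)%N.
Proof.
have [D -> DA] := conormal_sub_ker; have := mxrankS DA.
rewrite mxrank_ker; have := mxrankM_maxl D A1; have := rank_leq_row A2.
rewrite /r2; lia.
Qed.

Lemma conormal_rankY : (\rank Y + r1 <= p)%N.
Proof.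
have [_ _ [_ /mulmx0_rank_max]] := (conormal_block A1 A2 v X1 Y Z).1 cX.
by rewrite addnC.
Qed.

Lemma conormal_kerZ : A1 *m X1 = 0 -> (\rank Z + r2 <= q)%N.
Proof.
move=> AX; have [_ _ []] := (conormal_block A1 A2 v X1 Y Z).1 cX.
by rewrite AX add0r => /mulmx0_rank_max; rewrite addnC.
Qed.

(** Subtracting (X1, 0) from (X1, Y) leaves (0, Y) in W, so the rows of [Y] lie in W ∩ V2, of
    dimension k - r1. *)
Lemma conormal_imY : (row_mx X1 (0 : 'M_(p, q)) <= row_mx A1 A2)%MS ->
  (\rank Y + r1 <= k)%N.
Proof.
move=> X1A; have [_ _ _ XYA _] := (conormal_block A1 A2 v X1 Y Z).1 cX.
have: (row_mx 0 Y <= row_mx A1 A2)%MS.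
  have -> : row_mx 0 Y = row_mx X1 Y - row_mx X1 0.
    by rewrite opp_row_mx add_row_mx subrr oppr0 addr0.
  by apply: addmx_sub; rewrite ?eqmx_opp.
case/submxP=> D; rewrite mul_mx_row => /eq_row_mx[/esym/mulmx0_rank_max + ->].
have := mxrankM_maxl D A2; rewrite /r1; lia.
Qed.

Lemma conormal_vZ : (v <= Z)%MS -> xtype A1 A2 v = 1%N.
Proof.
have [_ _ _ _ ZA] := (conormal_block A1 A2 v X1 Y Z).1 cX.
case/submxP=> D eD; rewrite /xtype; suff -> : (row_mx v 0 <= row_mx A1 A2)%MS by [].
apply: submx_trans ZA; apply/submxP; exists D.
by rewrite mul_mx_row mulmx0 -eD.
Qed.

Lemma conormal_vY : (v <= A1)%MS -> v *m Y = 0.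
Proof.
have [_ _ [_ AY] _ _] := (conormal_block A1 A2 v X1 Y Z).1 cX.
by case/submxP=> D ->; rewrite -mulmxA AY mulmx0.
Qed.

Lemma xtype1_sub : xtype A1 A2 v = 1%N -> (row_mx v 0 <= row_mx A1 A2)%MS.
Proof. by rewrite /xtype; case: ifP => //; case: ifP. Qed.

Lemma xtype3_notin : xtype A1 A2 v = 3%N <-> ~~ (v <= A1)%MS.
Proof.
rewrite /xtype; case: ifP => [/submxP[D]|_]; last by case: ifP.
by rewrite mul_mx_row => /eq_row_mx[-> _]; rewrite submxMl.
Qed.

Lemma xtype2P : xtype A1 A2 v = 2%N ->
  (v <= A1)%MS /\ ~~ (row_mx v 0 <= row_mx A1 A2)%MS.
Proof. by rewrite /xtype; case: ifP => //; case: ifP. Qed.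

Lemma xtype1_sub1 : xtype A1 A2 v = 1%N -> (v <= A1)%MS.
Proof.
by move/xtype1_sub/submxP=> [D]; rewrite mul_mx_row => /eq_row_mx[-> _]; rewrite submxMl.
Qed.

(** If W splits, its projection to V1 equals W ∩ V1, and no line lies in the first without lying in
    W. *)
Lemma xtype2_rank : row_free (row_mx A1 A2) -> xtype A1 A2 v = 2%N ->
  (k < r1 + r2)%N.
Proof.
move=> fA /xtype2P[/submxP[w ->] vA].
rewrite ltn_neqAle rank_sum_ge // andbT; apply: contra vA => /eqP ek.
have /sub_addsmxP[u ->] := submx_full w (kermx_add_full fA ek).
rewrite mulmxDl -[_ *m _ *m A1]mulmxA mulmx_ker mulmx0 add0r.
apply/submxP; exists (u.2 *m kermx A2).
by rewrite mul_mx_row -[_ *m _ *m A2]mulmxA mulmx_ker mulmx0.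
Qed.

(** X1 squares to zero, because its rows lie in L and L is killed by X1. The upper left block of the
    square of X is therefore Y Z. *)
Lemma conormal_nil : Y *m Z = 0 /\ Z *m Y = 0.
Proof.
have [X1v vX [AXZ AY] XYA ZA] := (conormal_block A1 A2 v X1 Y Z).1 cX.
have X11 : X1 *m X1 = 0.
  by have [c eX] := submxP X1v; rewrite {1}eX -mulmxA vX mulmx0.
split; last first.
  by have [D -> _] := conormal_sub_ker; rewrite -mulmxA AY mulmx0.
have [D] := submxP XYA; rewrite mul_mx_row => /eq_row_mx[eX eY].
have : D *m (A1 *m X1 + A2 *m Z) = 0 by rewrite AXZ mulmx0.
by rewrite mulmxDr !mulmxA -eX -eY X11 add0r.
Qed.

(** A nonzero X1 would have row space L inside the projection of W, so X1 = 0. If moreover v Y = 0,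
    then [Y] is killed by [col_mx A1 v], of rank r1 + 1; hence the strict inequality. *)
Lemma conormal3 : xtype A1 A2 v = 3%N ->
  [/\ X1 = 0, (\rank Z + r2 <= q)%N, (\rank Y + r1 <= k)%N, ~~ (v <= Z)%MS &
     v *m Y = 0 -> (\rank Y + r1 < p)%N].
Proof.
move=> T3; have vA := xtype3_notin.1 T3.
have [X1v _ [_ AY] /submxP[D]] := (conormal_block A1 A2 v X1 Y Z).1 cX.
rewrite mul_mx_row => /eq_row_mx[eX _] _.
have X0 : X1 = 0.
  apply: contraNeq vA => /(line_sub X1v); move/submx_trans; apply.
  by rewrite eX submxMl.
split=> //.
- by apply: conormal_kerZ; rewrite X0 mulmx0.
- by apply: conormal_imY; rewrite X0 row_mx0 sub0mx.
- by apply/negP=> /conormal_vZ; rewrite T3.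
move=> vY; have: col_mx A1 v *m Y = 0 by rewrite mul_col_mx AY vY col_mx0.
by move/mulmx0_rank_max; rewrite rank_col_mx_notin // addnC addnS.
Qed.

(** If A1 X1 = - A2 Z were nonzero, its row space would be L, which would lie in that of [Z] and so
    in W. Similarly, x with x Y = 0 and x X1 nonzero would put L in W, so ker Y is contained in ker
    X1. For the bound k + 1: if (X1, Y) = D (A1, A2), then D A1 = X1 has rank at most 1, so [D] has
    rank at most k - r1 + 1. *)
Lemma conormal2 : xtype A1 A2 v = 2%N ->
  [/\ A1 *m X1 = 0 /\ (\rank Z + r2 <= q)%N, (\rank Y + r1 <= k.+1)%N,
     ~~ (v <= Z)%MS, v *m Y = 0 & \rank (row_mx X1 Y) = \rank Y].
Proof.
move=> T2; have [vA vnA] := xtype2P T2.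
have [X1v _ [AXZ AY] XYA ZA] := (conormal_block A1 A2 v X1 Y Z).1 cX.
have AX : A1 *m X1 = 0.
  apply: contraNeq vnA => AX0.
  have vAX : (v <= A1 *m X1)%MS by apply: line_sub => //; apply: mulmx_sub.
  have [D ->] := submxP vAX.
  move/eqP: AXZ; rewrite addr_eq0 => /eqP->.
  have -> : row_mx (D *m - (A2 *m Z)) 0 = (- D *m A2) *m row_mx Z (0 : 'M_q).
    by rewrite mul_mx_row mulmx0 mulmxN !mulNmx mulmxA.
  exact: mulmx_sub.
split=> //.
- by split=> //; apply: conormal_kerZ.
- have [D] := submxP XYA; rewrite mul_mx_row => /eq_row_mx[eX ->].
  have rX : (\rank X1 <= 1)%N.
    by apply: leq_trans (mxrankS X1v) _; rewrite rank_rV leq_b1.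
  have := mxrank_mul_min D A1; rewrite -eX.
  have := mxrankM_maxl D A2; rewrite /r1; lia.
- by apply/negP=> /conormal_vZ; rewrite T2.
- exact: conormal_vY.
rewrite -[RHS](mxrank_tr) -mxrank_tr tr_row_mx -addsmxE; apply/eqP.
rewrite eqn_leq; apply/andP; split; last by rewrite mxrankS // addsmxSr.
rewrite mxrankS // addsmx_sub submx_refl andbT.
have kYX : kermx Y *m X1 = 0.
  apply: kermx_mul0P => x xY; apply/eqP; apply: contraNT vnA => xX.
  have vx : (v <= x *m X1)%MS by apply: line_sub => //; apply: mulmx_sub.
  have [c ->] := sub_rVP vx.
  have -> : row_mx (c *: (x *m X1)) 0 = (c *: x) *m row_mx X1 Y.
    by rewrite mul_mx_row -!scalemxAl xY scaler0.
  exact: mulmx_sub.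
by have [D ->] := mulmx_ker_extend kYX; rewrite trmx_mul submxMl.
Qed.

(** A2 Z = - A1 X1 has its rows in L, so its rank is at most 1, whence [q.+1]. It is killed by both
    kernels, and thus vanishes if W splits. In the last clause [Z] fills W ∩ V1, which contains
    L. *)
Lemma conormal1 : row_free (row_mx A1 A2) -> v != 0 -> xtype A1 A2 v = 1%N ->
  [/\ (\rank Z + r2 <= q.+1)%N, (\rank Y + r1 <= k)%N, v *m Y = 0,
     (A1 *m X1 != 0 -> (v <= Z)%MS) &
     (k = r1 + r2)%N -> A1 *m X1 = 0]
  /\ ((\rank Z + r2 = k)%N -> (v <= Z)%MS).
Proof.
move=> fA v0 T1; have vA := xtype1_sub T1; have vA1 := xtype1_sub1 T1.
have [X1v vX [AXZ AY] XYA ZA] := (conormal_block A1 A2 v X1 Y Z).1 cX.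
have [D eZ Dk] := conormal_sub_ker.
have AXv : (A1 *m X1 <= v)%MS by apply: mulmx_sub.
have AZ : A2 *m Z = - (A1 *m X1) by apply/eqP; rewrite -addr_eq0 addrC AXZ.
split; first split.
- have := mxrank_mul_min A2 Z; rewrite AZ mxrank_opp.
  have := mxrankS AXv; rewrite rank_rV v0 /r2; lia.
- apply: conormal_imY; have [E eE] := submxP X1v.
  apply: submx_trans vA; apply/submxP; exists E.
  by rewrite mul_mx_row mulmx0 eE.
- exact: conormal_vY.
- move=> AX; have := line_sub AXv AX; move/submx_trans; apply.
  by rewrite -[A1 *m X1]opprK -AZ eqmx_opp submxMl.
- move=> ek.
  have k2X : kermx A2 *m (A1 *m X1) = 0.
    by rewrite -[A1 *m X1]opprK -AZ mulmxN !mulmxA mulmx_ker mul0mx oppr0.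
  have k1X : kermx A1 *m (A1 *m X1) = 0 by rewrite mulmxA mulmx_ker mul0mx.
  have full := kermx_add_full fA ek.
  apply: (row_full_inj (A := col_mx (kermx A1) (kermx A2))).
    by rewrite /row_full -addsmxE.
  by rewrite mulmx0 mul_col_mx k1X k2X col_mx0.
move=> rZ; have [w] := submxP vA; rewrite mul_mx_row => /eq_row_mx[ev ew].
have wk : (w <= kermx A2)%MS by rewrite sub_kermx -ew.
have [E eE] := submxP Dk; have [u eu] := submxP wk.
have sD : (kermx A2 *m A1 <= Z)%MS.
  have ZK : (Z <= kermx A2 *m A1)%MS by rewrite eZ eE -mulmxA submxMl.
  rewrite -(mxrank_leqif_sup ZK) eqn_leq mxrankS //=.
  apply: leq_trans (mxrankM_maxl _ _) _; rewrite mxrank_ker.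
  by move: rZ; rewrite /r2; lia.
by apply: submx_trans sD; rewrite ev eu -mulmxA submxMl.
Qed.

End Bounds.
End ConormalFiber.

(** * Generic points *)

Section Minors.
Variable F : fieldType.

(** Compressions [U *m M *m V] play the role of minors: for constant [U] and [V] their determinants
    are polynomials in the entries of [M]. *)
Lemma rank_geP m n (M : 'M[F]_(m, n)) c :
  (c <= \rank M)%N -> exists U V, U *m M *m V = 1%:M :> 'M_c.
Proof.
move=> cM; exists (pid_mx c *m invmx (col_ebase M)), (invmx (row_ebase M) *m pid_mx c).
rewrite -{2}[M]mulmx_ebase !mulmxA mulmxKV ?col_ebase_unit //.
rewrite mulmxK ?row_ebase_unit // !mul_pid_mx.
have := rank_leq_row M; have := rank_leq_col M => cn cm.
by rewrite -[RHS]pid_mx_1; congr pid_mx; lia.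
Qed.

Lemma rank_leP m n (M : 'M[F]_(m, n)) c :
  (\rank M <= c)%N <-> forall U V, \det (U *m M *m V : 'M_c.+1) = 0.
Proof.
split=> [cM U V|H].
  apply/eqP/negPn; rewrite -unitfE -unitmxE; apply/negP=> /mxrank_unit e.
  have := mxrankM_maxl (U *m M) V; have := mxrankM_maxr U M; lia.
rewrite leqNgt; apply/negP=> /rank_geP[U [V]] e.
by have /eqP := H U V; rewrite e det1 oner_eq0.
Qed.

Lemma rank_mulmx3 m n c d r (N : 'M[F]_(m, c)) (B : 'M_(d, n)) :
    \rank N = c -> \rank B = d -> (r <= c)%N -> (r <= d)%N ->
  \rank (N *m pid_mx r *m B) = r.
Proof.
move=> rN rB rc rd; rewrite mxrankMfree; last by rewrite /row_free rB.
rewrite -mxrank_tr trmx_mul mxrankMfree; last by rewrite /row_free mxrank_tr rN.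
by rewrite mxrank_tr rank_pid_mx.
Qed.

Lemma col_neq0 m n (M : 'M[F]_(m, n)) : M != 0 -> exists j, col j M != 0.
Proof.
move=> M0; apply/existsP; rewrite -negb_forall; apply: contra M0 => /forallP H.
apply/eqP/trmx_inj/row_matrixP=> j.
by rewrite -tr_col (eqP (H j)) !trmx0 row0.
Qed.

Lemma column_kernel m n c (A : 'M[F]_(m, n)) : (\rank A + c = n)%N ->
  exists2 N : 'M_(n, c), A *m N = 0 & \rank N = c.
Proof.
move=> e; have rk : \rank (kermx A^T) = c by rewrite mxrank_ker mxrank_tr; lia.
have [B [eB _]] := basis_of rk (sub0mx 1 _).
exists B^T; last by rewrite mxrank_tr eB.
apply: trmx_inj; rewrite trmx_mul trmxK trmx0; apply/eqP.
by rewrite -sub_kermx eB.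
Qed.

End Minors.

(** * Generic points of a line *)

Section Cofinite.
Variable F : numFieldType.

(** Witnessed by a polynomial rather than a finite set: intersections become products, and an
    equation valid off its roots extends to the whole line after multiplication by it. *)
Definition cofinite (P : F -> Prop) : Prop :=
  exists2 g : {poly F}, g != 0 & forall t, g.[t] != 0 -> P t.

Lemma cofiniteI P Q : cofinite P -> cofinite Q -> cofinite (fun t => P t /\ Q t).
Proof.
move=> [g g0 gP] [h h0 hQ]; exists (g * h); first by rewrite mulf_neq0.
by move=> t; rewrite hornerM mulf_eq0 negb_or => /andP[/gP ? /hQ].
Qed.

(** In characteristic zero the natural numbers already provide too many roots. *)
Lemma poly_vanishing (g : {poly F}) : (forall t, g.[t] = 0) -> g = 0.
Proof.
move=> g0; apply/eqP/negPn/negP=> gn0.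
have := max_poly_roots gn0 (rs := [seq i%:R | i <- iota 0 (size g)]).
rewrite size_map size_iota ltnn => H; apply: notF; apply: H.
  by apply/allP=> x _; rewrite rootE g0.
by rewrite map_inj_uniq ?iota_uniq // => i j /eqP; rewrite eqr_nat => /eqP.
Qed.

Lemma cofinite_ex P : cofinite P -> exists t, P t.
Proof.
move=> [g g0 gP]; apply: contrapT => nP.
case/eqP: g0; apply: poly_vanishing => t; apply/eqP/negPn/negP=> /gP Pt.
by apply: nP; exists t.
Qed.

(** A compression equal to the identity at [t0] has a determinant that is polynomial in [t] and
    equal to 1 at [t0]. *)
Lemma rank_cofinite m n (M N : 'M[F]_(m, n)) c t0 :
  (c <= \rank (M + t0 *: N)%R)%N -> cofinite (fun t => (c <= \rank (M + t *: N)%R)%N).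
Proof.
case/rank_geP=> U [V UV].
pose P := map_mx polyC (U *m M *m V) + 'X *: map_mx polyC (U *m N *m V).
have PE t : (\det P).[t] = \det (U *m (M + t *: N) *m V).
  rewrite -horner_evalE -det_map_mx; congr (\det _).
  rewrite mulmxDr mulmxDl -scalemxAr -scalemxAl.
  by apply/matrixP=> i j; rewrite !mxE /= horner_evalE !hornerE.
exists (\det P).
  by apply/eqP=> P0; have /eqP := PE t0; rewrite P0 UV det1 horner0 eq_sym oner_eq0.
move=> t; rewrite PE -unitfE -unitmxE => /mxrank_unit <-.
exact: leq_trans (mxrankM_maxl _ _) (mxrankM_maxr _ _).
Qed.

(** Only the traces on lines of a Zariski open condition are ever used. *)
Definition lineopen (V : lmodType F) (P : V -> Prop) : Prop :=
  forall X D t0, P (X + t0 *: D) -> cofinite (fun t => P (X + t *: D)).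

Lemma lineopenI (V : lmodType F) (P Q : V -> Prop) :
  lineopen P -> lineopen Q -> lineopen (fun X => P X /\ Q X).
Proof. by move=> oP oQ X D t0 [/oP ? /oQ ?]; apply: cofiniteI. Qed.

Lemma lineopen_if (V : lmodType F) (b : bool) (P : V -> Prop) :
  (b -> lineopen P) -> lineopen (fun X => b -> P X).
Proof.
case: b => [/(_ isT) oP X D t0 /(_ isT)/oP[g g0 gP]|_ X D t0 _].
  by exists g => // t /gP.
by exists 1 => //; apply: oner_neq0.
Qed.

Lemma lineopen_rank (V : lmodType F) m n (f : V -> 'M[F]_(m, n)) g c :
  (forall X D t, f (X + t *: D) = f X + t *: g D) ->
  lineopen (fun X => (c <= \rank (f X))%N).
Proof.
move=> fE X D t0; rewrite fE => /rank_cofinite[h h0 hP].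
by exists h => // t /hP; rewrite fE.
Qed.

(* On the line through a point of P and a point of Q, both are cofinite. *)
Lemma lineopen_ex (V : lmodType F) (L P Q : V -> Prop) :
    (forall X X' t, L X -> L X' -> L (X + t *: (X' - X))) ->
    lineopen P -> lineopen Q ->
    (exists2 X, L X & P X) -> (exists2 X, L X & Q X) ->
  exists2 X, L X & P X /\ Q X.
Proof.
move=> aL oP oQ [X LX PX] [X' LX' QX'].
have [t Ht] : exists t, P (X + t *: (X' - X)) /\ Q (X + t *: (X' - X)).
  apply/cofinite_ex/cofiniteI.
    by apply: (oP _ _ 0); rewrite scale0r addr0.
  by apply: (oQ _ _ 1); rewrite scale1r addrC subrK.
by exists (X + t *: (X' - X)) => //; apply: aL.
Qed.

End Cofinite.

(** * Conormal vectors attaining the bounds *)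

Section Existence.
Variables (F : fieldType) (p q k : nat).
Variables (A1 : 'M[F]_(k, p)) (A2 : 'M[F]_(k, q)) (v : 'rV[F]_p).
Hypothesis fA : row_free (row_mx A1 A2).

(** Columns are taken in the right kernel of [A], rows in the image of [kermx A] under [B], and
    [pid_mx r] joins the two. The pair (A2, A1) yields [Z], the pair (A1, A2) yields [Y]. *)
Lemma hom_exists m n (A : 'M[F]_(k, m)) (B : 'M_(k, n)) r :
    (kermx A :&: kermx B = 0)%MS -> (r + \rank A <= m)%N -> (r + \rank A <= k)%N ->
  exists W D, [/\ A *m W = 0, W = D *m B, D *m A = 0 & \rank W = r].
Proof.
move=> dAB rm rk; have eN : (\rank A + (m - \rank A) = m)%N by lia.
have [N AN rN] := column_kernel eN.
have rB : \rank (kermx A *m B) = (k - \rank A)%N.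
  by rewrite -mxrank_ker; apply/mxrank_injP; rewrite dAB.
exists (N *m pid_mx r *m row_base (kermx A *m B)).
have [D eD] : exists D, row_base (kermx A *m B) = D *m (kermx A *m B).
  by apply/submxP; rewrite eq_row_base.
exists (N *m pid_mx r *m (D *m kermx A)); split.
- by rewrite !mulmxA AN !mul0mx.
- by rewrite {1}eD !mulmxA.
- by rewrite -!mulmxA mulmx_ker !mulmx0.
apply: rank_mulmx3 => //; first by rewrite eq_row_base.
  by lia.
by rewrite rB; lia.
Qed.

Lemma exists_rankZ r : (r + \rank A2 <= q)%N -> (r + \rank A2 <= k)%N ->
  exists2 Z, conormal A1 A2 v (block_mx 0 0 Z 0) & \rank Z = r.
Proof.
have d : (kermx A2 :&: kermx A1 = 0)%MS by rewrite capmxC kermx_cap_row_free.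
move=> h1 h2; have [Z [D [AZ eZ DA rZ]]] := hom_exists d h1 h2.
exists Z => //; apply/conormal_block; split; rewrite ?mulmx0 ?sub0mx ?AZ ?addr0 //.
  by rewrite row_mx0 sub0mx.
by apply/submxP; exists D; rewrite mul_mx_row DA -eZ.
Qed.

Lemma exists_rankY r : (r + \rank A1 <= p)%N -> (r + \rank A1 <= k)%N ->
  exists2 Y, conormal A1 A2 v (block_mx 0 Y 0 0) & \rank Y = r.
Proof.
have d : (kermx A1 :&: kermx A2 = 0)%MS by rewrite kermx_cap_row_free.
move=> h1 h2; have [Y [D [AY eY DA rY]]] := hom_exists d h1 h2.
exists Y => //; apply/conormal_block; split; rewrite ?mulmx0 ?sub0mx ?addr0 //.
  by apply/submxP; exists D; rewrite mul_mx_row DA -eY.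
by rewrite row_mx0 sub0mx.
Qed.

Lemma row_mx_sub_block d (X1 : 'M[F]_p) (Y : 'M_(p, q)) (N : 'M_(p, d)) C1 C2 :
    X1 = N *m C1 -> Y = N *m C2 -> (row_mx C1 C2 <= row_mx A1 A2)%MS ->
    (v <= A1)%MS -> (C1 <= v)%MS -> A1 *m N = 0 ->
  conormal A1 A2 v (block_mx X1 Y 0 0).
Proof.
move=> -> -> CA /submxP[w ->] Cv AN; apply/conormal_block; split.
- exact: mulmx_sub.
- by rewrite -mulmxA [A1 *m _]mulmxA AN mul0mx mulmx0.
- by rewrite !mulmxA AN !mul0mx mulmx0 addr0.
- by rewrite -mul_mx_row mulmx_sub.
- by rewrite row_mx0 sub0mx.
Qed.

(** A column killed by [A1] but not by v, times a nonzero row of W ∩ V2. *)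
Lemma exists_vY : ~~ (v <= A1)%MS -> (\rank A1 < k)%N ->
  exists2 Y, conormal A1 A2 v (block_mx 0 Y 0 0) & (1 <= \rank (v *m Y))%N.
Proof.
rewrite submxE => vA rk.
have [j nj] : exists j, v *m col j (cokermx A1) != 0.
  by have [j] := col_neq0 vA; rewrite colE -mulmxA -colE; exists j.
have rB : \rank (kermx A1 *m A2) = (k - \rank A1)%N.
  by rewrite -mxrank_ker; apply/mxrank_injP; rewrite kermx_cap_row_free.
have /rowV0Pn[d dB d0] : kermx A1 *m A2 != 0 by rewrite -mxrank_eq0 rB; lia.
exists (col j (cokermx A1) *m d).
  apply/conormal_block; split; rewrite ?mulmx0 ?sub0mx ?addr0 //.
  - by rewrite mulmxA colE mulmxA mulmx_coker !mul0mx.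
  - have [D ->] := submxP dB; move: (mulmx_ker A1); set K := kermx A1 => KA.
    apply/submxP; exists (col j (cokermx A1) *m D *m K).
    by rewrite mul_mx_row -[_ *m K *m A1]mulmxA KA mulmx0 !mulmxA.
  - by rewrite row_mx0 sub0mx.
by rewrite lt0n mxrank_eq0 mulmxA mulmx_free_eq0 // /row_free rank_rV d0.
Qed.

Hypothesis v0 : v != 0.

(** The rows of (X1, Y) are taken among the vectors of W that project into L. These are spanned by W
    ∩ V2 and the lift (v, w A2) of v, and have dimension k - r1 + 1. *)
Lemma exists_rankX1Y r : (v <= A1)%MS -> (r + \rank A1 <= p)%N ->
    (r + \rank A1 <= k.+1)%N ->
  exists X1 Y, conormal A1 A2 v (block_mx X1 Y 0 0) /\ \rank (row_mx X1 Y) = r.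
Proof.
move=> vA rp rk; have [w ev] := submxP vA.
have eN : (\rank A1 + (p - \rank A1) = p)%N by lia.
have [N AN rN] := column_kernel eN.
pose B := row_base (kermx A1 *m A2).
pose C1 : 'M_(\rank (kermx A1 *m A2) + 1, p) := col_mx 0 v.
pose C2 := col_mx B (w *m A2).
have rB : \rank (kermx A1 *m A2) = (k - \rank A1)%N.
  by rewrite -mxrank_ker; apply/mxrank_injP; rewrite kermx_cap_row_free.
exists (N *m pid_mx r *m C1), (N *m pid_mx r *m C2); split.
  apply: row_mx_sub_block (erefl _) (erefl _) _ vA _ _.
  - rewrite -[row_mx _ _]block_mxEh block_mxEv col_mx_sub; apply/andP; split.
      have [D eD] : exists D, B = D *m (kermx A1 *m A2).
        by apply/submxP; rewrite eq_row_base.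
      apply/submxP; exists (D *m kermx A1).
      by rewrite mul_mx_row -mulmxA mulmx_ker mulmx0 eD mulmxA.
    by apply/submxP; exists w; rewrite mul_mx_row ev.
  - by rewrite col_mx_sub sub0mx submx_refl.
  - by rewrite mulmxA AN mul0mx.
rewrite -mul_mx_row rank_mulmx3 //; last 2 first.
- by lia.
- by rewrite rB; have := rank_leq_row A1; lia.
rewrite -[row_mx _ _]block_mxEh block_mxEv.
rewrite rank_col_mx_notin ?rank_row_0mx ?eq_row_base ?addn1 //.
apply/negP=> /submxP[D]; rewrite mul_mx_row mulmx0 => /eq_row_mx[v00 _].
by move: v0; rewrite v00 eqxx.
Qed.

Lemma exists_X1 : (v <= A1)%MS -> (\rank A1 < p)%N ->
  exists X1 Y, conormal A1 A2 v (block_mx X1 Y 0 0) /\ (1 <= \rank X1)%N.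
Proof.
move=> vA rp; have [w ev] := submxP vA.
have [j nj] : exists j, col j (cokermx A1) != 0.
  by apply: col_neq0; rewrite -mxrank_eq0 mxrank_coker; lia.
exists (col j (cokermx A1) *m v), (col j (cokermx A1) *m (w *m A2)); split.
  apply: row_mx_sub_block (erefl _) (erefl _) _ vA (submx_refl _) _.
    by apply/submxP; exists w; rewrite mul_mx_row ev.
  by rewrite colE mulmxA mulmx_coker mul0mx.
by rewrite lt0n mxrank_eq0 mulmx_free_eq0 // /row_free rank_rV v0.
Qed.

Section TypeOne.
Hypothesis vA : (row_mx v 0 <= row_mx A1 A2)%MS.

Lemma type1_vS : (v <= kermx A2 *m A1)%MS.
Proof.
have [w] := submxP vA; rewrite mul_mx_row => /eq_row_mx[-> ew].
by apply: submxMr; rewrite sub_kermx -ew.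
Qed.

Lemma kermx_rank : \rank (kermx A2 *m A1) = (k - \rank A2)%N.
Proof.
by rewrite -mxrank_ker; apply/mxrank_injP; rewrite capmxC kermx_cap_row_free.
Qed.

Lemma type1_complement : exists B : 'M_(k - \rank A2 - 1, p),
  [/\ (B <= kermx A2 *m A1)%MS, \rank B = (k - \rank A2 - 1)%N & ~~ (v <= B)%MS].
Proof.
have r1 : (0 < k - \rank A2)%N.
  by rewrite -kermx_rank; apply: leq_trans (mxrankS type1_vS); rewrite rank_rV v0.
have rS : \rank (kermx A2 *m A1) = (\rank v + (k - \rank A2 - 1))%N.
  by rewrite kermx_rank rank_rV v0; lia.
have [B [eB _]] := basis_between type1_vS rS (sub0mx 1 _).
have rB : \rank B = (k - \rank A2 - 1)%N.
  apply/eqP; rewrite eqn_leq rank_leq_row /=.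
  have := (mxrank_adds_leqif v B).1; rewrite eB rS; lia.
exists B; split=> //; first by rewrite -eB addsmxSr.
apply/negP=> /addsmx_idPr e; have := kermx_rank.
by rewrite -eB e rB; lia.
Qed.

Lemma sub_kerA1 m (Z : 'M[F]_(m, p)) : (Z <= kermx A2 *m A1)%MS ->
  (row_mx Z (0 : 'M_(m, q)) <= row_mx A1 A2)%MS.
Proof.
case/submxP=> D ->; apply/submxP; exists (D *m kermx A2).
by rewrite mul_mx_row mulmxA -[_ *m _ *m A2]mulmxA mulmx_ker mulmx0.
Qed.

Lemma exists_Zv r : (r + \rank A2 < k)%N -> (r + \rank A2 <= q)%N ->
  exists2 Z, conormal A1 A2 v (block_mx 0 0 Z 0) & \rank (col_mx Z v) = r.+1.
Proof.
move=> rk rq; have [B [BS rB vB]] := type1_complement.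
have eN : (\rank A2 + (q - \rank A2) = q)%N by lia.
have [N AN rN] := column_kernel eN.
have ZB : (N *m pid_mx r *m B <= B)%MS by apply: submxMl.
exists (N *m pid_mx r *m B).
  apply/conormal_block; split; rewrite ?mulmx0 ?sub0mx ?row_mx0 ?sub0mx //.
    by rewrite !mulmxA AN !mul0mx addr0.
  by apply/sub_kerA1/(submx_trans ZB).
rewrite rank_col_mx_notin; last by apply: contra vB => /submx_trans; apply.
by rewrite rank_mulmx3 //; lia.
Qed.

Hypothesis rk : (k < \rank A1 + \rank A2)%N.

(** As W does not split, W ∩ V1 is smaller than the projection of W to V1, so some functional [n]
    vanishes on the former but not on the latter. Then A1 n vanishes on [kermx A2], so it factors
    through [A2], which gives [m]. *)
Lemma type1_column : exists (n : 'cV[F]_p) (m : 'cV_q),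
  [/\ kermx A2 *m A1 *m n = 0, A1 *m n != 0 & A1 *m n + A2 *m m = 0].
Proof.
have nA : ~~ (A1 <= kermx A2 *m A1)%MS.
  by apply/negP=> /mxrankS; rewrite kermx_rank; have := rank_leq_row A2; lia.
rewrite submxE in nA.
have [j nj] : exists j, A1 *m col j (cokermx (kermx A2 *m A1)) != 0.
  by have [j] := col_neq0 nA; rewrite colE -mulmxA -colE; exists j.
set n := col j _ in nj; have kn : kermx A2 *m A1 *m n = 0.
  by rewrite /n colE mulmxA mulmx_coker mul0mx.
have [m em] := mulmx_ker_extend (etrans (mulmxA _ _ _) kn).
by exists n, (- m); split; rewrite // mulmxN -em subrr.
Qed.

Lemma type1_conormal (n : 'cV[F]_p) (m : 'cV_q) (Z0 : 'M_(q, p)) :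
    kermx A2 *m A1 *m n = 0 -> A1 *m n + A2 *m m = 0 ->
    A2 *m Z0 = 0 -> (Z0 <= kermx A2 *m A1)%MS ->
  conormal A1 A2 v (block_mx (n *m v) 0 (Z0 + m *m v) 0).
Proof.
move=> kn nm AZ ZS; have vn : v *m n = 0.
  by have [u ->] := submxP type1_vS; rewrite -mulmxA kn mulmx0.
apply/conormal_block; split.
- exact: submxMl.
- by rewrite mulmxA vn mul0mx.
- by rewrite mulmxDr AZ add0r !mulmxA -mulmxDl nm mul0mx mulmx0.
- by apply: sub_kerA1; rewrite mulmx_sub ?type1_vS.
- by apply: sub_kerA1; rewrite addmx_sub ?mulmx_sub ?type1_vS.
Qed.

Lemma exists_A1X1 : exists X1 Z,
  conormal A1 A2 v (block_mx X1 0 Z 0) /\ (1 <= \rank (A1 *m X1))%N.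
Proof.
have [n [m [kn An nm]]] := type1_column.
exists (n *m v), (0 + m *m v); split.
  by apply: type1_conormal; rewrite ?mulmx0 ?sub0mx.
by rewrite lt0n mxrank_eq0 mulmxA mulmx_free_eq0 // /row_free rank_rV v0.
Qed.

Lemma exists_rankZ_type1 : (q < k)%N -> exists X1 Z,
  conormal A1 A2 v (block_mx X1 0 Z 0) /\ \rank Z = (q.+1 - \rank A2)%N.
Proof.
move=> qk; have [n [m [kn An nm]]] := type1_column.
have [B [BS rB vB]] := type1_complement.
have r2q := rank_leq_col A2; have eN : (\rank A2 + (q - \rank A2) = q)%N by lia.
have [N AN rN] := column_kernel eN.
pose P : 'M[F]_(q - \rank A2, k - \rank A2 - 1) := pid_mx (q - \rank A2).
have PB : (P *m B <= B)%MS by apply: submxMl.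
exists (n *m v), (N *m (P *m B) + m *m v); split.
  apply: type1_conormal => //; first by rewrite mulmxA AN mul0mx.
  by apply: mulmx_sub; apply: submx_trans BS.
(* The left factor has independent columns because [A2] kills [N] but not [m]; the right one has
   independent rows because v is outside [B]. By q < k, [B] has at least q - r2 rows. *)
have -> : N *m (P *m B) + m *m v = row_mx N m *m col_mx (P *m B) v.
  by rewrite mul_row_col.
rewrite mxrankMfree; last first.
  rewrite /row_free rank_col_mx_notin; last first.
    by apply: contra vB => /submx_trans; apply.
  rewrite mxrankMfree ?rank_pid_mx ?addn1 //; last by rewrite /row_free rB.
  by lia.
rewrite -mxrank_tr tr_row_mx rank_col_mx_notin ?mxrank_tr ?rN; first by lia.
apply/negP=> /submxP[D /(congr1 trmx)]; rewrite trmx_mul !trmxK => em.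
by move: nm An; rewrite em mulmxA AN mul0mx addr0 => ->; rewrite eqxx.
Qed.

End TypeOne.
End Existence.

(* The invariants (rk x_12, rk x_21, type of L) of the orbit attached to the
   orbit of (W, L), where r1, r2 are the dimensions of the projections of W. *)
Definition phi (p q k r1 r2 T : nat) : nat * nat * nat :=
  if T == 3%N then (minn k q - r2, minn k p - r1, if r1 < k then 3 else 2)%N
  else if T == 2%N then (minn k q - r2, minn k.+1 p - r1, 2)%N
  else if (k < r1 + r2)%N then (minn k q.+1 - r2, minn k p - r1, 1)%N
  else (minn k q - r2, minn k p - r1, if k <= q then 1 else 2)%N.

Section Generic.
Variables (F : numFieldType) (p q k : nat).
Variables (A1 : 'M[F]_(k, p)) (A2 : 'M[F]_(k, q)) (v : 'rV[F]_p).
Hypotheses (fA : row_free (row_mx A1 A2)) (v0 : v != 0).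

Local Notation r1 := (\rank A1).
Local Notation r2 := (\rank A2).
Local Notation T := (xtype A1 A2 v).
Local Notation V := 'M[F]_(p + q).

Lemma conormal_line (X X' : V) (t : F) : conormal A1 A2 v X ->
  conormal A1 A2 v X' -> conormal A1 A2 v (X + t *: (X' - X)).
Proof.
have lin (M M' : V) : drsubmx M = 0 -> drsubmx M' = 0 ->
    drsubmx (M + t *: (M' - M)) = 0 /\
    ulsubmx (M + t *: (M' - M)) = ulsubmx M + t *: (ulsubmx M' - ulsubmx M).
  move=> e e'; split; last by apply/matrixP=> i j; rewrite !mxE.
  apply/matrixP=> i j; move/matrixP/(_ i j): e; move/matrixP/(_ i j): e'.
  by rewrite !mxE => -> ->; rewrite subrr mulr0 addr0.
move=> [d u vu AX XA] [d' u' vu' AX' XA']; have [ed eu] := lin _ _ d d'.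
split; rewrite ?eu //.
- by rewrite addmx_sub // scalemx_sub // addmx_sub // eqmx_opp.
- by rewrite mulmxDr -scalemxAr mulmxBr vu vu' subrr scaler0 addr0.
- by rewrite mulmxDr -scalemxAr mulmxBr AX AX' subrr scaler0 addr0.
- by rewrite addmx_sub // scalemx_sub // addmx_sub // eqmx_opp.
Qed.

(** Everything, nonvanishing included, is phrased as a lower bound on a rank, so that one openness
    lemma covers all clauses. The premises depend only on (W, L) and are constant on the fiber. Some
    clauses fix the invariants, others serve to exclude foreign strata. *)
Definition generic (X : V) : Prop :=
  let X1 := ulsubmx X in let Y := ursubmx X in let Z := dlsubmx X in
  (minn k q - r2 <= \rank Z)%N /\ (minn k p - r1 <= \rank Y)%N /\
  ((T < 3)%N -> (minn k.+1 p - r1 <= \rank (row_mx X1 Y))%N) /\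
  ((T < 3)%N && (r1 < p)%N -> (1 <= \rank X1)%N) /\
  ((T == 3%N) && (r1 < k)%N -> (1 <= \rank (v *m Y))%N) /\
  ((T == 1%N) && (k < r1 + r2)%N -> (1 <= \rank (A1 *m X1))%N) /\
  ([&& T == 1%N, (k < r1 + r2)%N & (q < k)%N] -> (q.+1 - r2 <= \rank Z)%N) /\
  (T == 1%N -> (minn k q.+1 - r2 <= \rank (col_mx Z v))%N).

Lemma conormal0 : conormal A1 A2 v 0.
Proof.
split; rewrite ?mulmx0 ?sub0mx //.
- by apply/matrixP=> i j; rewrite !mxE.
- suff -> : ulsubmx (0 : V) = 0 by rewrite sub0mx.
  by apply/matrixP=> i j; rewrite !mxE.
- suff -> : ulsubmx (0 : V) = 0 by rewrite mulmx0.
  by apply/matrixP=> i j; rewrite !mxE.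
Qed.

Definition opendense (P : V -> Prop) : Prop :=
  lineopen P /\ exists2 X, conormal A1 A2 v X & P X.

Lemma opendenseI P Q :
  opendense P -> opendense Q -> opendense (fun X => P X /\ Q X).
Proof.
move=> [oP exP] [oQ exQ]; split; first exact: lineopenI.
exact: lineopen_ex conormal_line oP oQ exP exQ.
Qed.

Lemma opendense_if (b : bool) P :
  (b -> opendense P) -> opendense (fun X => b -> P X).
Proof.
move=> bP; split; first by apply: lineopen_if => /bP[].
case: b bP => [/(_ isT)[_ [X cX PX]]|_]; first by exists X.
by exists 0 => //; apply: conormal0.
Qed.

Lemma opendense_rank m n (f g : V -> 'M[F]_(m, n)) c :
    (forall X D t, f (X + t *: D) = f X + t *: g D) ->
    (exists2 X, conormal A1 A2 v X & (c <= \rank (f X))%N) ->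
  opendense (fun X => (c <= \rank (f X))%N).
Proof. by move=> fE exf; split => //; apply: lineopen_rank fE. Qed.

(** Each bound needs only some conormal vector attaining it, possibly a different one for each
    bound; [opendenseI] finds a common one. *)
Lemma opendense_generic : opendense generic.
Proof.
have r1k := rank_leq_row A1; have r1p := rank_leq_col A1.
have r2k := rank_leq_row A2; have r2q := rank_leq_col A2.
have T12 : (T < 3)%N -> (v <= A1)%MS.
  by move=> T3; apply/negPn/negP=> /xtype3_notin e; rewrite e in T3.
have ulE (X D : V) t : ulsubmx (X + t *: D) = ulsubmx X + t *: ulsubmx D.
  by apply/matrixP=> i j; rewrite !mxE.
have urE (X D : V) t : ursubmx (X + t *: D) = ursubmx X + t *: ursubmx D.
  by apply/matrixP=> i j; rewrite !mxE.
have dlE (X D : V) t : dlsubmx (X + t *: D) = dlsubmx X + t *: dlsubmx D.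
  by apply/matrixP=> i j; rewrite !mxE.
rewrite /generic /=; do ![apply: opendenseI]; do ?[apply: opendense_if => H].
- apply: (opendense_rank dlE).
  have [||Z cZ rZ] := @exists_rankZ _ _ _ _ _ _ v fA (minn k q - r2)%N; try lia.
  by exists (block_mx 0 0 Z 0) => //; rewrite block_mxKdl rZ.
- apply: (opendense_rank urE).
  have [||Y cY rY] := @exists_rankY _ _ _ _ _ _ v fA (minn k p - r1)%N; try lia.
  by exists (block_mx 0 Y 0 0) => //; rewrite block_mxKur rY.
- apply: (opendense_rank (g := fun D => row_mx (ulsubmx D) (ursubmx D))).
    by move=> X D t; rewrite scale_row_mx add_row_mx ulE urE.
  have [||X1 [Y [cX rX]]] :=
    @exists_rankX1Y _ _ _ _ _ _ _ fA v0 (minn k.+1 p - r1)%N (T12 H); try lia.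
  by exists (block_mx X1 Y 0 0) => //; rewrite block_mxKul block_mxKur rX.
- apply: (opendense_rank ulE); case/andP: H => /T12 vA r1p'.
  have [X1 [Y [cX rX]]] := exists_X1 fA v0 vA r1p'.
  by exists (block_mx X1 Y 0 0) => //; rewrite block_mxKul.
- apply: (opendense_rank (g := fun D => v *m ursubmx D)).
    by move=> X D t; rewrite urE mulmxDr scalemxAr.
  case/andP: H => /eqP/xtype3_notin vA r1k'.
  have [Y cY rY] := exists_vY fA vA r1k'.
  by exists (block_mx 0 Y 0 0) => //; rewrite block_mxKur.
- apply: (opendense_rank (g := fun D => A1 *m ulsubmx D)).
    by move=> X D t; rewrite ulE mulmxDr scalemxAr.
  case/andP: H => /eqP/xtype1_sub vA rk.
  have [X1 [Z [cX rX]]] := exists_A1X1 fA v0 vA rk.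
  by exists (block_mx X1 0 Z 0) => //; rewrite block_mxKul.
- apply: (opendense_rank dlE); case/and3P: H => /eqP/xtype1_sub vA rk qk.
  have [X1 [Z [cX rX]]] := exists_rankZ_type1 fA v0 vA rk qk.
  by exists (block_mx X1 0 Z 0) => //; rewrite block_mxKdl rX.
- apply: (opendense_rank (g := fun D => col_mx (dlsubmx D) 0)).
    by move=> X D t; rewrite scale_col_mx add_col_mx scaler0 addr0 dlE.
  have vA := xtype1_sub (eqP H); have vS := mxrankS (type1_vS vA).
  rewrite kermx_rank // rank_rV v0 in vS.
  have [||Z cZ rZ] :=
    @exists_Zv _ _ _ _ _ _ _ fA v0 vA (minn k q.+1 - r2).-1%N; try lia.
  exists (block_mx 0 0 Z 0) => //; rewrite block_mxKdl rZ; lia.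
Qed.

End Generic.

(** The three alternatives ask, respectively, that im Z is nonzero, that ker Y is larger than im Z,
    and that ker Y is not all of V1. *)
Definition nil_admissible (p q k s t ty : nat) : Prop :=
  [/\ (s + t <= minn k (p + q - k))%N, (s + t <= minn p q)%N &
   [\/ ty = 1%N /\ (0 < s)%N, ty = 2%N /\ (s + t < p)%N | ty = 3%N /\ (0 < t)%N]].

Lemma etype_nil_admissible (F : fieldType) p q k (Y : 'M[F]_(p, q)) (Z : 'M_(q, p))
    (v : 'rV_p) :
    v != 0 -> Y *m Z = 0 -> Z *m Y = 0 ->
    (\rank Z + \rank Y <= minn k (p + q - k))%N ->
  nil_admissible p q k (\rank Z) (\rank Y) (etype Y Z v).
Proof.
move=> v0 YZ ZY rk.
have bY := mulmx0_rank_max YZ; have bZ := mulmx0_rank_max ZY.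
split=> //; first by rewrite leq_min bZ addnC bY.
rewrite /etype; case: ifP => vZ.
  constructor 1; split=> //; apply: leq_trans (mxrankS vZ).
  by rewrite rank_rV v0.
case: eqP => vY; last first.
  constructor 3; split=> //; rewrite lt0n mxrank_eq0; apply: contra_notN vY.
  by move/eqP->; rewrite mulmx0.
constructor 2; split=> //.
have: col_mx Z v *m Y = 0 by rewrite mul_col_mx ZY vY col_mx0.
by move/mulmx0_rank_max; rewrite rank_col_mx_notin ?vZ.
Qed.

(** * Invariants of generic points and closed conditions on strata *)

Section Invariants.
Variables (F : numFieldType) (p q k : nat).
Variables (A1 : 'M[F]_(k, p)) (A2 : 'M[F]_(k, q)) (v : 'rV[F]_p).
Hypotheses (fA : row_free (row_mx A1 A2)) (v0 : v != 0).

Local Notation r1 := (\rank A1).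
Local Notation r2 := (\rank A2).
Local Notation T := (xtype A1 A2 v).

Variables (X1 : 'M[F]_p) (Y : 'M[F]_(p, q)) (Z : 'M[F]_(q, p)).
Hypothesis cX : conormal A1 A2 v (block_mx X1 Y Z 0).

(** The generic lower bounds meet the upper bounds that hold on the whole fiber. *)
Lemma generic_invariants : generic A1 A2 v (block_mx X1 Y Z 0) ->
  (\rank Z, \rank Y, etype Y Z v) = phi p q k r1 r2 T.
Proof.
rewrite /generic block_mxKul block_mxKur block_mxKdl.
have r1k := rank_leq_row A1; have r1p := rank_leq_col A1.
have r2k := rank_leq_row A2; have r2q := rank_leq_col A2.
have k12 := rank_sum_ge fA; have uZ := conormal_rankZ cX.
have uY := conormal_rankY cX.
move=> [gZ [gY [gXY [gX1 [gvY [gAX [gZ' gZv]]]]]]].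
have pair3 (a b c a' b' c' : nat) : a = a' -> b = b' -> c = c' ->
  (a, b, c) = (a', b', c') by move=> -> -> ->.
rewrite /phi /etype; case: (xtypeP A1 A2 v) => eT; rewrite eT /= in gXY gX1 gvY gAX gZ' gZv *.
- have [[u1 u2 u3 u4 u5] u6] := conormal1 cX fA v0 eT.
  have := gZv isT; rewrite u3 eqxx => {}gZv.
  case: ltnP => rk in gAX gZ' *.
    have AX : A1 *m X1 != 0 by rewrite -mxrank_eq0 -lt0n gAX.
    by rewrite (u4 AX); apply: pair3 => //; lia.
  have ek : k = (r1 + r2)%N by lia.
  have AX := u5 ek; have uZ' := conormal_kerZ cX AX.
  case: leqP => kq.
    by rewrite u6; [apply: pair3|]; lia.
  (* If v were in the row space of [Z], then [col_mx Z v] would have the rank of [Z], at most q -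
     r2, contrary to [gZv]. *)
  case: ifP => [vZ|_]; last by apply: pair3; lia.
  by move: gZv; rewrite -addsmxE (addsmx_idPl vZ); lia.
- have [[u1 u2] u3 u4 u5 u6] := conormal2 cX eT.
  rewrite (negPf u4) u5 eqxx; apply: pair3 => //; first by lia.
  by have := gXY isT; rewrite u6; lia.
have [u1 u2 u3 u4 u5] := conormal3 cX eT.
rewrite (negPf u4); apply: pair3; [lia|lia|].
case: ltnP => rk in gvY *.
  by have := gvY isT; rewrite lt0n mxrank_eq0 => /negPf->.
suff -> : Y = 0 by rewrite mulmx0 eqxx.
by apply/eqP; rewrite -mxrank_eq0; lia.
Qed.

(** The extra 1 in the bound on [Z] (position 1) or on [Y] (position 2) occurs only if k < r1 + r2,
    and this strict inequality compensates it in the bound on the sum of the ranks. *)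
Lemma conormal_nil_admissible :
  nil_admissible p q k (\rank Z) (\rank Y) (etype Y Z v).
Proof.
have [YZ ZY] := conormal_nil cX; apply: etype_nil_admissible => //.
have r1k := rank_leq_row A1; have r1p := rank_leq_col A1.
have r2k := rank_leq_row A2; have r2q := rank_leq_col A2.
have k12 := rank_sum_ge fA; have uZ := conormal_rankZ cX.
have uY := conormal_rankY cX.
have [eT|eT|eT] := xtypeP A1 A2 v.
- have [[u1 u2 u3 u4 u5] u6] := conormal1 cX fA v0 eT.
  case: (ltnP k (r1 + r2)) => rk; first by lia.
  have ek : k = (r1 + r2)%N by lia.
  by have uZ' := conormal_kerZ cX (u5 ek); lia.
- have [[u1 u2] u3 u4 u5 u6] := conormal2 cX eT.
  by have := xtype2_rank fA eT; lia.
by have [u1 u2 u3 u4 u5] := conormal3 cX eT; lia.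
Qed.

(* Closed conditions that hold on the preimage of the orbit with invariants
   (s, t, ty); together they exclude the generic points of every conormal bundle
   whose image under phi is not (s, t, ty). *)
Definition stratum_bounds (s t ty : nat) (B1 : 'M[F]_(k, p)) (B2 : 'M[F]_(k, q))
    (w : 'rV[F]_p) (X : 'M[F]_(p + q)) : Prop :=
  let U1 := ulsubmx X in let U := ursubmx X in let W := dlsubmx X in
  (\rank W <= s)%N /\ (\rank U <= t)%N /\
  (\rank B2 <= (if ty == 1%N then minn k q.+1 else minn k q) - s)%N /\
  (\rank B1 <= (if ty == 2%N then minn k.+1 p else minn k p) - t)%N /\
  (ty == 3%N -> (\rank U1 <= 0)%N) /\
  (ty == 1%N -> (\rank (col_mx (row_mx B1 B2) (row_mx w 0)) <= k)%N) /\
  (ty == 1%N -> (\rank (col_mx W w) <= s)%N) /\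
  (ty == 2%N -> (\rank (w *m U) <= 0)%N) /\
  (ty == 2%N -> (\rank (B1 *m U1) <= 0)%N) /\
  ((ty == 2%N) && (1 <= t)%N -> (\rank (col_mx B1 w) <= k)%N) /\
  ([&& ty == 2%N, (k <= q)%N, (k < p)%N & s + t == k]%N ->
     (\rank (row_mx U1 U) <= t)%N).

(** The position of L relative to W is not constant on the preimage, so each bound has to hold for
    all positions compatible with [etype]. *)
Lemma stratum_boundsP :
  stratum_bounds (\rank Z) (\rank Y) (etype Y Z v) A1 A2 v (block_mx X1 Y Z 0).
Proof.
rewrite /stratum_bounds block_mxKul block_mxKur block_mxKdl.
have r1k := rank_leq_row A1; have r1p := rank_leq_col A1.
have r2k := rank_leq_row A2; have r2q := rank_leq_col A2.
have k12 := rank_sum_ge fA; have uZ := conormal_rankZ cX.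
have uY := conormal_rankY cX.
have r0 m n (M : 'M[F]_(m, n)) : M = 0 -> (\rank M <= 0)%N.
  by move=> ->; rewrite mxrank0.
split=> //; split=> //; rewrite /etype.
case: (boolP (v <= Z)%MS) => vZ /=.
  have eT := conormal_vZ cX vZ; have vA := xtype1_sub eT.
  have [[u1 u2 u3 u4 u5] u6] := conormal1 cX fA v0 eT.
  do ![split] => //; try lia.
    by rewrite -addsmxE (addsmx_idPl vA) rank_leq_row.
  by rewrite -addsmxE (addsmx_idPl vZ).
have [eT|eT|eT] := (xtypeP A1 A2 v).
- have [[u1 u2 u3 u4 u5] u6] := conormal1 cX fA v0 eT.
  have AX : A1 *m X1 = 0.
    by apply/eqP/negPn; apply/negP=> /u4; apply/negP.
  have uZ' := conormal_kerZ cX AX; have vA := xtype1_sub1 eT.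
  rewrite u3 eqxx /=; do ![split] => //; try lia.
  + by move=> _; rewrite mxrank0.
  + by rewrite AX mxrank0.
  + by rewrite -addsmxE (addsmx_idPl vA).
- have [[u1 u2] u3 u4 u5 u6] := conormal2 cX eT.
  have [vA vnA] := xtype2P eT.
  rewrite u5 eqxx u6 /=; do ![split] => //; try lia.
  + by move=> _; rewrite mxrank0.
  + by rewrite u1 mxrank0.
  + by rewrite -addsmxE (addsmx_idPl vA).
have [u1 u2 u3 u4 u5] := conormal3 cX eT.
have [vY|vY] := eqVneq (v *m Y) 0; rewrite u1 mulmx0 mxrank0 /=; last first.
  by do ![split] => //; lia.
rewrite rank_row_0mx; do ![split] => //; try lia.
- by rewrite vY mxrank0.
- by rewrite mxrank0.
have vA := (xtype3_notin A1 A2 v).1 eT.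
by rewrite rank_col_mx_notin //; lia.
Qed.

(** The bounds on [Z] and [Y] bound s and t from below, those on [A1] and [A2] from above, which
    pins them down; the clauses depending on [ty] rule out the wrong positions. *)
Lemma generic_stratum s t ty : generic A1 A2 v (block_mx X1 Y Z 0) ->
    nil_admissible p q k s t ty ->
    stratum_bounds s t ty A1 A2 v (block_mx X1 Y Z 0) ->
  (s, t, ty) = phi p q k r1 r2 T.
Proof.
move=> gX; have := generic_invariants gX; move: gX.
rewrite /generic /stratum_bounds block_mxKul block_mxKur block_mxKdl.
have r1k := rank_leq_row A1; have r1p := rank_leq_col A1.
have r2k := rank_leq_row A2; have r2q := rank_leq_col A2.
have k12 := rank_sum_ge fA; have uZ := conormal_rankZ cX.
have uY := conormal_rankY cX.
have pair3 (a b c a' b' c' : nat) : a = a' -> b = b' -> c = c' ->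
  (a, b, c) = (a', b', c') by move=> -> -> ->.
move=> [gZ [gY [gXY [gX1 [gvY [gAX [gZ' gZv]]]]]]].
move=> ephi [st1 st2 tyE].
move=> [cZ [cY [cA2 [cA1 [cX1 [cvA [cZv [cvY [cAX [cAv cXY]]]]]]]]]].
have notA : ~~ (v <= A1)%MS -> \rank (col_mx A1 v) = r1.+1.
  exact: rank_col_mx_notin.
have notW : ~~ (row_mx v 0 <= row_mx A1 A2)%MS ->
    \rank (col_mx (row_mx A1 A2) (row_mx v 0)) = k.+1.
  by move=> h; rewrite rank_col_mx_notin // (eqP fA).
have AX1 : (\rank (A1 *m X1) <= \rank X1)%N := mxrankM_maxr A1 X1.
have tri : [\/ T = 1%N, T = 2%N | T = 3%N] := (xtypeP A1 A2 v).
move: ephi; rewrite /phi; case: tri => eT.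
all: rewrite eT /= in gXY gX1 gvY gAX gZ' gZv *.
- case: ltnP => rk in gAX gZ' *; case=> eZ eY eE; case: tyE => -[ety st3];
    rewrite ety /= in cA2 cA1 cX1 cvA cZv cvY cAX cAv cXY *.
  + apply: pair3 => //; first by move: cZ eZ cA2 st1 st2; clear; lia.
    by move: cY eY cA1 st1 st2; clear; lia.
  + by have := cAX isT; have := gAX isT; case: (\rank _).
  + by have := cX1 isT; have := gAX isT; move: AX1; clear; lia.
  + have := cZv isT; have := gZv isT.
    case: (leqP k q) => kq h1 h2; apply: pair3 => //;
      move: h1 h2 kq cZ cY cA2 cA1 eZ eY k12 rk st1 st2 r1p r2q r1k r2k;
      by clear; lia.
  + have ek : k = (r1 + r2)%N by move: k12 rk; clear; lia.
    have eS : s = (minn k q - r2)%N.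
      by move: cZ eZ cA2 st1 st2; clear; lia.
    have eT' : t = (minn k p - r1)%N.
      by move: cY eY cA1 st1 st2 eS ek r2k r2q r1p; clear; lia.
    (* For k <= q the image has position 1, so position 2 must be excluded although the ranks agree.
       This is the purpose of the last clause of [stratum_bounds]: generically (X1, Y) has rank at
       least k + 1 - r1, while t = k - r1. *)
    apply: pair3 => //; case: leqP => // kq; exfalso.
    have kp : (k < p)%N by move: ek eS eT' kq st3 r1p; clear; lia.
    have := gXY isT; have := cXY; rewrite kq kp /=.
    by have -> : (s + t == k)%N; [| move/(_ isT)]; move: r1k r2k ek eS eT' kq kp; clear; lia.
  + by have := cX1 isT; move: gX1 cA1 st2 st3 r1p; clear; lia.
- have [vA vnA] := xtype2P eT; have nW := notW vnA.
  case=> eZ eY eE; case: tyE => -[ety st3];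
    rewrite ety /= in cA2 cA1 cX1 cvA cZv cvY cAX cAv cXY *.
  + by have := cvA isT; rewrite nW ltnn.
  + apply: pair3 => //; first by move: cZ eZ cA2 st1 st2; clear; lia.
    by move: cY eY cA1 st1 st2; clear; lia.
  + by have := cX1 isT; move: gX1 cA1 st2 st3 r1p; clear; lia.
have vA := (xtype3_notin A1 A2 v).1 eT; have nA := notA vA.
case=> eZ eY eE; case: tyE => -[ety st3];
  rewrite ety /= in cA2 cA1 cX1 cvA cZv cvY cAX cAv cXY *.
- have := cvA isT; rewrite notW ?ltnn //; apply/negP=> vA'.
  by move: eT; rewrite /xtype vA'.
- have := cvY isT; case: ltnP => rk in gvY *.
    by have := gvY isT; case: (\rank _).
  have t0 : t = 0%N.
    by move: cAv; rewrite nA; move: cA1 rk; clear; lia.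
  move=> _; apply: pair3 => //; first by move: cZ eZ cA2 st1 st2; clear; lia.
  by move: cY eY t0; clear; lia.
have eT' : t = (minn k p - r1)%N by move: cY eY cA1 st1 st2; clear; lia.
apply: pair3 => //; first by move: cZ eZ cA2 st1 st2; clear; lia.
by case: ltnP => // rk; move: eT' st3 rk; clear; lia.
Qed.

End Invariants.

(** * Admissible invariants *)

(** The alternatives say that W ∩ V1 is nonzero, that W does not split, and that the projection of W
    to V1 is not onto. *)
Definition x_admissible (p q k r1 r2 T : nat) : Prop :=
  [/\ (r1 <= minn k p)%N, (r2 <= minn k q)%N, (k <= r1 + r2)%N &
   [\/ T = 1%N /\ (r2 < k)%N, T = 2%N /\ (k < r1 + r2)%N | T = 3%N /\ (r1 < p)%N]].

Lemma phi_surj p q k s t ty : (k <= p + q)%N -> nil_admissible p q k s t ty ->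
  exists r1 r2 T, x_admissible p q k r1 r2 T /\ phi p q k r1 r2 T = (s, t, ty).
Proof.
move=> kn [h1 h2 h3].
(* Each branch of [phi] can be solved for r1 and r2; [ok0] to [ok3] record when the solution is
   admissible, [ok0] being the split case of position 1. *)
have pair3 (a b c a' b' c' : nat) : a = a' -> b = b' -> c = c' ->
  (a, b, c) = (a', b', c') by move=> -> -> ->.
have ok2 r1 r2 : (r1 <= minn k p)%N -> (r2 <= minn k q)%N -> (k < r1 + r2)%N ->
    (minn k q - r2)%N = s -> (minn k.+1 p - r1)%N = t -> ty = 2%N ->
  exists r1 r2 T, x_admissible p q k r1 r2 T /\ phi p q k r1 r2 T = (s, t, ty).
  move=> a b c <- <- ->; exists r1, r2, 2%N; split=> //.
  by split=> //; [exact: ltnW|constructor 2].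
have ok3 r1 r2 : (r1 <= minn k p)%N -> (r2 <= minn k q)%N -> (k <= r1 + r2)%N ->
    (r1 < p)%N ->
    (minn k q - r2)%N = s -> (minn k p - r1)%N = t ->
    ty = (if (r1 < k)%N then 3 else 2)%N ->
  exists r1 r2 T, x_admissible p q k r1 r2 T /\ phi p q k r1 r2 T = (s, t, ty).
  move=> a b c d <- <- ->; exists r1, r2, 3%N; split=> //.
  by split=> //; constructor 3.
have ok1 r1 r2 : (r1 <= minn k p)%N -> (r2 <= minn k q)%N -> (k < r1 + r2)%N ->
    (r2 < k)%N ->
    (minn k q.+1 - r2)%N = s -> (minn k p - r1)%N = t -> ty = 1%N ->
  exists r1 r2 T, x_admissible p q k r1 r2 T /\ phi p q k r1 r2 T = (s, t, ty).
  move=> a b c d <- <- ->; exists r1, r2, 1%N; split; last by rewrite /phi /= c.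
  by split=> //; [exact: ltnW|constructor 1].
have ok0 r1 r2 : (r1 <= minn k p)%N -> (r2 <= minn k q)%N -> (k = r1 + r2)%N ->
    (r2 < k)%N ->
    (minn k q - r2)%N = s -> (minn k p - r1)%N = t ->
    ty = (if (k <= q)%N then 1 else 2)%N ->
  exists r1 r2 T, x_admissible p q k r1 r2 T /\ phi p q k r1 r2 T = (s, t, ty).
  move=> a b c d <- <- ->; exists r1, r2, 1%N; split.
    by split=> //; [rewrite -c|constructor 1].
  by rewrite /phi /= {1}c ltnn.
case: h3 => -[ety h].
- have [kq|kq] := leqP k q.
    have [e|e] := eqVneq (s + t)%N (minn k p).
      by apply: (ok0 (minn k p - t)%N (k - s)%N) => //; rewrite ?kq //;
        move: kn h1 h2 h ety kq e; clear; lia.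
    by apply: (ok1 (minn k p - t)%N (k - s)%N); move: kn h1 h2 h ety kq e; clear; lia.
  by apply: (ok1 (minn k p - t)%N (q.+1 - s)%N); move: kn h1 h2 h ety kq; clear; lia.
- have [pk|pk] := leqP p k.
    (* Here the candidate has r1 + r2 = k, which excludes position 2. Since q < k, a split W
       containing L has the required image. *)
    have [e|e] := eqVneq (s + t)%N (p + minn k q - k)%N.
      have kq : (q < k)%N by move: kn h1 h2 h pk e; clear; lia.
      by apply: (ok0 (p - t)%N (q - s)%N); rewrite ?[(k <= q)%N]leqNgt ?kq //;
        move: kn h1 h2 h pk kq e; clear; lia.
    by apply: (ok2 (p - t)%N (minn k q - s)%N); move: kn h1 h2 h pk e ety; clear; lia.
  (* For t = 0 position 2 would require r1 = k + 1; position 3 with r1 = k takes over. *)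
  case: t => [|t] in h1 h2 h ok0 ok1 ok2 ok3 *.
    apply: (ok3 k (minn k q - s)%N); rewrite ?ltnn //; move: kn h1 h2 h pk; clear; lia.
  by apply: (ok2 (k - t)%N (minn k q - s)%N); move: kn h1 h2 h pk ety; clear; lia.
have r1k : (minn k p - t < k)%N by move: kn h1 h2 h; clear; lia.
apply: (ok3 (minn k p - t)%N (minn k q - s)%N); rewrite ?r1k //; move: kn h1 h2 h; clear; lia.
Qed.

(** When q < k < p, a split W containing L, with ranks (r1, r2), has the image of position 2 with
    ranks (r1 + 1, r2), or, if r1 = k, of position 3 with the same ranks. These are the only
    coincidences. *)
Lemma phi_inj p q k r1 r2 T r1' r2' T' :
    x_admissible p q k r1 r2 T -> x_admissible p q k r1' r2' T' ->
    phi p q k r1 r2 T = phi p q k r1' r2' T' ->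
    (T == 1%N) = (T' == 1%N) \/ (p <= maxn k (maxn (p + q - k) q.+1))%N ->
  [/\ r1 = r1', r2 = r2' & T = T'].
Proof.
have pairE (a b c a' b' c' : nat) : (a, b, c) = (a', b', c') ->
  [/\ a = a', b = b' & c = c'] by case=> -> -> ->.
move=> [a1 a2 a3 a4] [b1 b2 b3 b4]; rewrite /phi.
case: a4 => -[-> a4]; case: b4 => -[-> b4] /=; repeat case: ifP => ?;
  move=> /pairE[e1 e2 e3] h; try discriminate; split=> //; try lia.
Qed.

(** * Realizing the admissible invariants *)

Section PointsOfX.
Variables (F : fieldType) (p q k : nat).

Lemma xtype_admissible (A1 : 'M[F]_(k, p)) (A2 : 'M_(k, q)) (v : 'rV_p) :
    row_free (row_mx A1 A2) -> v != 0 ->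
  x_admissible p q k (\rank A1) (\rank A2) (xtype A1 A2 v).
Proof.
move=> fA v0; split.
- by rewrite leq_min rank_leq_row rank_leq_col.
- by rewrite leq_min rank_leq_row rank_leq_col.
- exact: rank_sum_ge fA.
have [eT|eT|eT] := xtypeP A1 A2 v; rewrite eT.
- constructor 1; split=> //; rewrite -subn_gt0 -(kermx_rank fA).
  apply: leq_trans (mxrankS (type1_vS (xtype1_sub eT))).
  by rewrite rank_rV v0.
- by constructor 2; split=> //; apply: xtype2_rank fA eT.
- constructor 3; split=> //.
  rewrite -(rank_col_mx_notin ((xtype3_notin A1 A2 v).1 eT)).
  exact: rank_leq_col.
Qed.

Lemma row_mul_pid m n r (x : 'rV[F]_m) : x *m (pid_mx r : 'M_(m, n)) = 0 ->
  forall i : 'I_m, (i < r)%N -> (r <= n)%N -> x 0 i = 0.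
Proof.
move=> e i ir rn; have im : (i < n)%N by apply: leq_trans rn.
move/rowP/(_ (Ordinal im)): e; rewrite !mxE (bigD1 i) //= big1 => [|j ji].
  by rewrite mxE eqxx ir mulr1 addr0.
by move: ji; rewrite mxE -val_eqE /= => /negPf->; rewrite mulr0.
Qed.

Lemma exists_transverse r1 r2 : (r1 <= minn k p)%N -> (r2 <= minn k q)%N ->
    (k <= r1 + r2)%N ->
  exists (A1 : 'M[F]_(k, p)) (A2 : 'M[F]_(k, q)),
    [/\ row_free (row_mx A1 A2), \rank A1 = r1 & \rank A2 = r2].
Proof.
rewrite !leq_min => /andP[r1k r1p] /andP[r2k r2q] kr.
(* The first r1 rows of [A1] and, after reversal, the last r2 rows of [A2] are distinct unit
   vectors; k <= r1 + r2 leaves no row uncovered. *)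
pose s : 'S_k := perm (@rev_ord_inj k).
exists (pid_mx r1), (perm_mx s *m pid_mx r2); split.
- apply: inj_row_free => x; rewrite mul_mx_row mulmxA => e.
  have /eq_row_mx[e1 e2] : row_mx (x *m pid_mx r1) (x *m perm_mx s *m pid_mx r2)
    = row_mx 0 0 :> 'rV_(p + q) by rewrite e row_mx0.
  apply/rowP=> i; rewrite mxE.
  have [ir|ir] := ltnP i r1; first exact: row_mul_pid e1 _ ir r1p.
  have := row_mul_pid e2 (i := s i).
  rewrite -[s]invgK -col_permE mxE invgK permK => -> //.
  by rewrite permE /=; have := ltn_ord i; move: ir kr; clear; lia.
- by rewrite rank_pid_mx.
by rewrite (eqmxMfull (pid_mx r2)) ?rank_pid_mx // row_full_unit unitmx_perm.
Qed.

Lemma exists_xtype r1 r2 T : x_admissible p q k r1 r2 T ->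
  exists (A1 : 'M[F]_(k, p)) (A2 : 'M[F]_(k, q)) (v : 'rV[F]_p),
    [/\ row_free (row_mx A1 A2), v != 0 &
        [/\ \rank A1 = r1, \rank A2 = r2 & xtype A1 A2 v = T]].
Proof.
move=> [h1 h2 h3 h4]; have [A1 [A2 [fA e1 e2]]] := exists_transverse h1 h2 h3.
exists A1, A2; have rk := kermx_rank fA; rewrite e2 in rk.
have nz (v : 'rV[F]_p) (S : 'M[F]_(k, p)) : ~~ (v <= S)%MS -> v != 0.
  by apply: contraNneq => ->; rewrite sub0mx.
case: h4 => -[-> h4].
- have /rowV0Pn[v vS v0] : kermx A2 *m A1 != 0.
    by rewrite -mxrank_eq0 rk -lt0n subn_gt0.
  exists v; split=> //; split=> //; rewrite /xtype.
  by rewrite (sub_kerA1 vS).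
- have /row_subPn[i vS] : ~~ (A1 <= kermx A2 *m A1)%MS.
    by apply/negP=> /mxrankS; rewrite rk e1; move: h2 h4; clear; lia.
  exists (row i A1); split; rewrite ?(nz _ _ vS) //; split=> //; rewrite /xtype.
  rewrite row_sub; case: ifP => // vA; case/negP: vS; exact: type1_vS vA.
have /row_subPn[i vS] : ~~ ((1%:M : 'M[F]_p) <= A1)%MS.
  by apply/negP=> /mxrankS; rewrite mxrank1 e1; move: h4; clear; lia.
exists (row i 1%:M); split; rewrite ?(nz _ _ vS) //; split=> //.
exact/xtype3_notin.
Qed.

End PointsOfX.

(** * Subspaces and orbits as matrices *)

Section Translation.
Variables (R : realType) (p q : nat).
Local Notation C := (R[i]).
Local Notation n := (p + q)%N.

(* mxalgebra works with row spaces, hence the transpose. *)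
Definition sp m (A : 'M[C]_(m, n)) : {vspace 'cV[C]_n} := limg (lmul A^T).

Lemma lmulE m (A : 'M[C]_(n, m)) u : lmul A u = A *m u.
Proof. by rewrite lfunE. Qed.

Lemma mem_sp m (A : 'M[C]_(m, n)) w : (w \in sp A) = (w^T <= A)%MS.
Proof.
apply/memv_imgP/submxP => [[u _ ->]|[D eD]].
  by exists u^T; rewrite lmulE trmx_mul trmxK.
by exists D^T; rewrite ?memvf // lmulE -trmx_mul -eD trmxK.
Qed.

Lemma sp_sub m1 m2 (A : 'M[C]_(m1, n)) (B : 'M[C]_(m2, n)) :
  (sp A <= sp B)%VS = (A <= B)%MS.
Proof.
apply/subvP/idP => [H|AB w]; last by rewrite !mem_sp => /submx_trans; apply.
apply/rV_subP=> u uA; have := H u^T; rewrite !mem_sp trmxK; exact.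
Qed.

Lemma sp_eqP m1 m2 (A : 'M[C]_(m1, n)) (B : 'M[C]_(m2, n)) :
  sp A = sp B <-> (A :=: B)%MS.
Proof.
split=> [e|e]; first by apply/eqmxP; rewrite -!sp_sub e subvv.
by apply/eqP; rewrite eqEsubv !sp_sub !e submx_refl.
Qed.

Lemma dim_sp m (A : 'M[C]_(m, n)) : \dim (sp A) = \rank A.
Proof.
have -> : sp A = sp (row_base A) by apply/sp_eqP/eqmx_sym/eq_row_base.
rewrite /sp limg_dim_eq ?dimvf ?dim_matrix ?mulr1 //.
apply/eqP; rewrite -subv0; apply/subvP=> u; rewrite memv_cap memv_ker memvf lmulE /=.
rewrite -(inj_eq (@trmx_inj _ _ _)) trmx_mul trmxK trmx0.
rewrite mulmx_free_eq0 ?row_base_free // memv0 => /eqP e.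
by rewrite -[u]trmxK e trmx0.
Qed.

Lemma sp_surj (W : {vspace 'cV[C]_n}) :
  exists2 A : 'M[C]_(\dim W, n), row_free A & W = sp A.
Proof.
pose A := \matrix_(i < \dim W) ((vbasis W)`_i)^T.
have WA : W = sp A.
  apply/vspaceP=> w; rewrite mem_sp; apply/idP/submxP => [wW|[D eD]].
    exists (\row_i coord (vbasis W) i w); rewrite {1}(coord_vbasis wW).
    rewrite raddf_sum mulmx_sum_row; apply: eq_bigr => i _.
    by rewrite mxE rowK /= linearZ.
  rewrite -[w]trmxK eD mulmx_sum_row raddf_sum; apply: memv_suml => i _ /=.
  by rewrite rowK linearZ /= trmxK memvZ // vbasis_mem // mem_nth ?size_tuple.
by exists A => //; rewrite /row_free -dim_sp -WA.
Qed.

Lemma act_sp m (g : 'M[C]_n) (A : 'M[C]_(m, n)) :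
  (lmul g @: sp A)%VS = sp (A *m g^T).
Proof.
apply/vspaceP=> w; rewrite mem_sp; apply/memv_imgP/submxP => [[u]|[D eD]].
  rewrite mem_sp lmulE => /submxP[D eD] ->; exists D.
  by rewrite trmx_mul eD mulmxA.
exists (D *m A)^T; first by rewrite mem_sp trmxK submxMl.
by rewrite lmulE -[w]trmxK eD mulmxA trmx_mul trmxK.
Qed.

Lemma sp_ker m (A : 'M[C]_(m, n)) (X : 'M[C]_n) :
  (sp A <= lker (lmul X^T))%VS <-> A *m X = 0.
Proof.
split=> [/subvP H|AX].
  apply/row_matrixP=> i; rewrite row_mul row0.
  have := H (row i A)^T; rewrite mem_sp trmxK row_sub memv_ker lmulE -trmx_mul.
  move=> /(_ isT)/eqP e; apply: trmx_inj; by rewrite e trmx0.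
apply/subvP=> w; rewrite mem_sp memv_ker lmulE => /submxP[D eD].
by rewrite -[w]trmxK -trmx_mul eD -mulmxA AX mulmx0 trmx0.
Qed.

Lemma vline_sp (v : 'rV[C]_p) :
  <[col_mx v^T (0 : 'cV_q)]>%VS = sp (row_mx v 0).
Proof.
apply/vspaceP=> w; rewrite mem_sp; apply/vlineP/sub_rVP => -[c e]; exists c.
  by rewrite e linearZ /= tr_col_mx trmxK trmx0.
by apply: trmx_inj; rewrite e linearZ /= tr_col_mx trmxK trmx0.
Qed.

Lemma V1E : @V1 R p q = sp (row_mx 1%:M 0).
Proof. by rewrite /V1 /sp tr_row_mx trmx1 trmx0. Qed.

Lemma PV1P L : @PV1 R p q L <-> exists2 v : 'rV[C]_p, v != 0 & L = sp (row_mx v 0).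
Proof.
rewrite /PV1 /= V1E; split=> [[L1 LV]|[v v0 ->]].
  have [A fA eL] := sp_surj L; move: A fA eL; rewrite L1 => A fA eL.
  move: LV; rewrite eL sp_sub => /submxP[D eA].
  rewrite mul_mx_row mulmx1 mulmx0 in eA; exists D; last by rewrite -eA.
  apply: contraTneq fA => D0; rewrite eA D0 row_mx0 /row_free mxrank0.
  by [].
split; first by rewrite dim_sp rank_row_mx0 rank_rV v0.
by rewrite sp_sub; apply/submxP; exists v; rewrite mul_mx_row mulmx1 mulmx0.
Qed.

Lemma sp_line_eq (v v' : 'rV[C]_p) :
  sp (row_mx v 0) = sp (row_mx v' 0) <-> (v :=: v')%MS.
Proof.
have sub (x y : 'rV[C]_p) : (row_mx x (0 : 'rV_q) <= row_mx y (0 : 'rV_q))%MS = (x <= y)%MS.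
  apply/submxP/submxP => -[D eD]; exists D.
    by move: eD; rewrite mul_mx_row => /eq_row_mx[].
  by rewrite mul_mx_row mulmx0 -eD.
split=> [/sp_eqP e|e].
  by apply/eqmxP; rewrite -!sub !e !submx_refl.
by apply/sp_eqP/eqmxP; rewrite !sub !e submx_refl.
Qed.

Lemma etype_eqmx (Y : 'M[C]_(p, q)) (Z : 'M[C]_(q, p)) (v v' : 'rV[C]_p) :
  (v :=: v')%MS -> etype Y Z v = etype Y Z v'.
Proof.
move=> e; rewrite /etype e; suff -> : (v *m Y == 0) = (v' *m Y == 0) by [].
by rewrite -!mxrank_eq0 (eqmxMr Y e).
Qed.

Lemma xtype_eqmx k (A1 A1' : 'M[C]_(k, p)) (A2 A2' : 'M[C]_(k, q)) v v' :
    (row_mx A1 A2 :=: row_mx A1' A2')%MS -> (v :=: v')%MS ->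
  [/\ \rank A1 = \rank A1', \rank A2 = \rank A2' &
      xtype A1 A2 v = xtype A1' A2' v'].
Proof.
move=> eA ev.
have sub (B1 B1' : 'M[C]_(k, p)) (B2 B2' : 'M[C]_(k, q)) :
    (row_mx B1 B2 <= row_mx B1' B2')%MS -> (B1 <= B1')%MS /\ (B2 <= B2')%MS.
  by case/submxP=> D; rewrite mul_mx_row => /eq_row_mx[-> ->]; rewrite !submxMl.
have /sub[l1 l2] : (row_mx A1 A2 <= row_mx A1' A2')%MS by rewrite eA.
have /sub[l1' l2'] : (row_mx A1' A2' <= row_mx A1 A2)%MS by rewrite -eA.
have e1 : (A1 :=: A1')%MS by apply/eqmxP/andP.
have e2 : (A2 :=: A2')%MS by apply/eqmxP/andP.
split; [by rewrite e1|by rewrite e2|rewrite /xtype].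
have /sp_line_eq/sp_eqP ev' := ev.
by rewrite ev' eA ev e1.
Qed.
End Translation.

(** * Orbits as level sets of the invariants *)

Section Orbits.
Variables (R : realType) (p q k : nat).
Local Notation C := (R[i]).
Local Notation n := (p + q)%N.

Definition xpt (A1 : 'M[C]_(k, p)) (A2 : 'M[C]_(k, q)) (v : 'rV[C]_p) : Xpt R p q :=
  (sp (row_mx A1 A2), sp (row_mx v 0)).

Definition ept (v : 'rV[C]_p) (Y : 'M[C]_(p, q)) (Z : 'M[C]_(q, p)) : Ept R p q :=
  (sp (row_mx v 0), (block_mx 0 Y Z 0)^T).

Definition xstratum (r1 r2 T : nat) : set (Xpt R p q) :=
  [set w | exists A1 A2 v, [/\ row_free (row_mx A1 A2), v != 0,
    [/\ \rank A1 = r1, \rank A2 = r2 & xtype A1 A2 v = T] & w = xpt A1 A2 v]].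

Definition estratum (s t ty : nat) : set (Ept R p q) :=
  [set e | exists v Y Z, [/\ v != 0, Y *m Z = 0 /\ Z *m Y = 0,
    [/\ \rank Z = s, \rank Y = t & etype Y Z v = ty] & e = ept v Y Z]].

Lemma exotic_grassmannianP w : @exotic_grassmannian R p q k w <->
  exists A1 A2 v, [/\ row_free (row_mx A1 A2), v != 0 & w = xpt A1 A2 v].
Proof.
case: w => W L; split=> [[/= Wk /PV1P[v v0 ->]]|[A1 [A2 [v [fA v0 [-> ->]]]]]].
  have [A fA ->] := sp_surj W; move: A fA; rewrite Wk => A fA.
  by exists (lsubmx A), (rsubmx A), v; rewrite /xpt hsubmxK.
split; first by rewrite /Gr /= dim_sp; apply/eqP: fA.
by apply/PV1P; exists v.
Qed.

(** The transposes make K act on row spaces by right multiplication with [G1] and [G2]. *)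
Definition kel (G1 : 'M[C]_p) (G2 : 'M[C]_q) : 'M[C]_n := block_mx G1^T 0 0 G2^T.

Lemma kel_Kgroup G1 G2 : G1 \in unitmx -> G2 \in unitmx ->
  @Kgroup R p q (kel G1 G2).
Proof. by move=> u1 u2; exists G1^T, G2^T; rewrite !unitmx_tr. Qed.

Lemma KgroupP g : @Kgroup R p q g -> exists G1 G2,
  [/\ G1 \in unitmx, G2 \in unitmx & g = kel G1 G2].
Proof.
by case=> g1 [g2 [u1 u2 ->]]; exists g1^T, g2^T; rewrite !unitmx_tr /kel !trmxK.
Qed.

Lemma tr_kel G1 G2 : (kel G1 G2)^T = block_mx G1 0 0 G2.
Proof. by rewrite tr_block_mx !trmxK !trmx0. Qed.

Lemma act_xpt G1 G2 A1 A2 v :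
  actX (kel G1 G2) (xpt A1 A2 v) = xpt (A1 *m G1) (A2 *m G2) (v *m G1).
Proof.
by rewrite /actX /xpt /= !act_sp tr_kel !mul_row_block !mulmx0 !mul0mx !addr0 !add0r.
Qed.

Lemma xtype_unit G1 G2 (A1 : 'M[C]_(k, p)) (A2 : 'M[C]_(k, q)) v :
    G1 \in unitmx -> G2 \in unitmx ->
  [/\ row_free (row_mx (A1 *m G1) (A2 *m G2)) = row_free (row_mx A1 A2),
      (v *m G1 != 0) = (v != 0), \rank (A1 *m G1) = \rank A1,
      \rank (A2 *m G2) = \rank A2 &
      xtype (A1 *m G1) (A2 *m G2) (v *m G1) = xtype A1 A2 v].
Proof.
move=> u1 u2; have f1 : row_free G1 by rewrite row_free_unit.
have f2 : row_free G2 by rewrite row_free_unit.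
have fb : row_free (block_mx G1 0 0 G2).
  by rewrite /row_free rank_diag_block_mx (eqP f1) (eqP f2).
have blk m (B1 : 'M[C]_(m, p)) (B2 : 'M[C]_(m, q)) :
    row_mx (B1 *m G1) (B2 *m G2) = row_mx B1 B2 *m block_mx G1 0 0 G2.
  by rewrite mul_row_block !mulmx0 addr0 add0r.
split.
- by rewrite blk /row_free mxrankMfree.
- by rewrite mulmx_free_eq0.
- by rewrite mxrankMfree.
- by rewrite mxrankMfree.
rewrite /xtype submxMfree // -[X in row_mx _ X](mul0mx _ G2) !blk.
by rewrite submxMfree.
Qed.

Lemma xstratum_orbit r1 r2 T w : xstratum r1 r2 T w ->
  [set actX g w | g in @Kgroup R p q] = xstratum r1 r2 T.
Proof.
move=> [A1 [A2 [v [fA v0 [e1 e2 eT] ->]]]]; apply/seteqP; split=> [_ [g Kg <-]|].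
  have [G1 [G2 [u1 u2 ->]]] := KgroupP Kg.
  have [h1 h2 h3 h4 h5] := xtype_unit A1 A2 v u1 u2.
  exists (A1 *m G1), (A2 *m G2), (v *m G1).
  by rewrite act_xpt h1 h2 h3 h4 h5.
move=> _ [B1 [B2 [w0 [fB w00 [d1 d2 dT] ->]]]].
have eT' : xtype A1 A2 v = xtype B1 B2 w0 by rewrite eT dT.
have [c1 c2] : (row_mx v 0 <= row_mx A1 A2)%MS = (row_mx w0 0 <= row_mx B1 B2)%MS
    /\ (v <= A1)%MS = (w0 <= B1)%MS.
  have [xT|xT|xT] := xtypeP A1 A2 v; have xT' := xT; rewrite eT' in xT'.
  - by rewrite (xtype1_sub xT) (xtype1_sub xT') (xtype1_sub1 xT) (xtype1_sub1 xT').
  - have [-> /negPf->] := xtype2P xT.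
    by have [-> /negPf->] := xtype2P xT'.
  have nA := (xtype3_notin _ _ _).1 xT; have nB := (xtype3_notin _ _ _).1 xT'.
  rewrite (negPf nA) (negPf nB); split=> //.
  have -> : (row_mx v 0 <= row_mx A1 A2)%MS = false.
    by apply/negP=> h; move: xT; rewrite /xtype h.
  by apply/esym/negP=> h; move: xT'; rewrite /xtype h.
have [E [G1 [G2 [[Eu u1 u2] [h1 h2 h3]]]]] := exotic_grassmannian_classification
  fA fB v0 w00 (etrans e1 (esym d1)) (etrans e2 (esym d2)) c1 c2.
exists (kel G1 G2); first exact: kel_Kgroup.
rewrite act_xpt h1 h2 h3 /xpt -mul_mx_row; congr pair.
by apply/sp_eqP; apply: eqmxMfull; rewrite row_full_unit.
Qed.

Lemma orbitsXP (O : set (Xpt R p q)) : orbitsX R p q k O <->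
  exists r1 r2 T, x_admissible p q k r1 r2 T /\ O = xstratum r1 r2 T.
Proof.
split=> [[w /exotic_grassmannianP[A1 [A2 [v [fA v0 ew]]]] ->]|].
  exists (\rank A1), (\rank A2), (xtype A1 A2 v).
  split; first exact: xtype_admissible.
  by apply: xstratum_orbit; exists A1, A2, v.
move=> [r1 [r2 [T [adm ->]]]].
have [A1 [A2 [v [fA v0 inv]]]] := exists_xtype C adm.
exists (xpt A1 A2 v); first by apply/exotic_grassmannianP; exists A1, A2, v.
by rewrite (@xstratum_orbit r1 r2 T) //; exists A1, A2, v.
Qed.

Lemma xstratum_inj r1 r2 T r1' r2' T' w :
    xstratum r1 r2 T w -> xstratum r1' r2' T' w ->
  [/\ r1 = r1', r2 = r2' & T = T'].
Proof.
move=> [A1 [A2 [v [fA v0 [<- <- <-] ->]]]] [B1 [B2 [u [fB u0 [<- <- <-]]]]].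
by case=> /sp_eqP e /sp_line_eq ev; apply: xtype_eqmx.
Qed.

Lemma theta_tr (X : 'M[C]_n) :
  theta X^T = (block_mx (ulsubmx X) 0 0 (drsubmx X))^T.
Proof. by rewrite /theta -trmx_ulsub -trmx_drsub tr_block_mx !trmx0. Qed.

Lemma mtheta_tr (X : 'M[C]_n) :
  mtheta X^T = (block_mx 0 (ursubmx X) (dlsubmx X) 0)^T.
Proof. by rewrite /mtheta -trmx_dlsub -trmx_ursub tr_block_mx !trmx0. Qed.

Lemma rank_antidiag (Y : 'M[C]_(p, q)) (Z : 'M[C]_(q, p)) :
  \rank (block_mx 0 Y Z 0) = (\rank Z + \rank Y)%N.
Proof.
rewrite -(rank_diag_block_mx Z Y) block_mxEv -addsmxE addsmxC addsmxE.
by rewrite block_mxEv.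
Qed.

Lemma exotic_nilconeP e : @exotic_nilcone R p q k e <->
  exists v Y Z, [/\ v != 0, Y *m Z = 0 /\ Z *m Y = 0,
    (\rank Z + \rank Y <= minn k (n - k))%N & e = ept v Y Z].
Proof.
case: e => L x; rewrite -[x]trmxK; move: (x^T) => {x} X; split.
  move=> [/= /PV1P[v v0 ->] [th nil rk]].
  have eX : X = block_mx 0 (ursubmx X) (dlsubmx X) 0.
    move/(congr1 trmx): th; rewrite theta_tr trmxK trmx0.
    rewrite -(block_mx0 C p q p q) => /eq_block_mx[d1 _ _ d2].
    by rewrite -{1}[X]submxK d1 d2.
  exists v, (ursubmx X), (dlsubmx X); split=> //; last 2 first.
  - by rewrite -rank_antidiag -eX -mxrank_tr.
  - by rewrite /ept -eX.
  move/(congr1 trmx): nil; rewrite -trmx_mul trmxK trmx0.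
  rewrite eX mulmx_block !mul0mx !mulmx0 !addr0 !add0r -(block_mx0 C p q p q).
  by case/eq_block_mx; rewrite block_mxKur block_mxKdl.
move=> [v [Y [Z [v0 [YZ ZY] rk [-> /trmx_inj->]]]]]; split=> /=.
  by apply/PV1P; exists v.
split.
- rewrite theta_tr block_mxKul block_mxKdr block_mx0; exact: trmx0.
- rewrite -trmx_mul mulmx_block !mul0mx !mulmx0 !addr0 !add0r YZ ZY block_mx0.
  exact: trmx0.
by rewrite mxrank_tr rank_antidiag.
Qed.

Lemma act_ept G1 G2 v Y Z Y' Z' : G1 \in unitmx -> G2 \in unitmx ->
    Y *m G2 = G1 *m Y' -> Z *m G1 = G2 *m Z' ->
  actE (kel G1 G2) (ept v Y Z) = ept (v *m G1) Y' Z'.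
Proof.
move=> u1 u2 eY eZ; rewrite /actE /ept /= act_sp tr_kel mul_row_block.
rewrite !mulmx0 mul0mx !addr0; congr pair.
have ku : kel G1 G2 \in unitmx.
  by rewrite -unitmx_tr tr_kel -row_free_unit /row_free rank_diag_block_mx
    !mxrank_unit.
apply: (canLR (mulmxK ku)); apply: trmx_inj.
rewrite !trmx_mul !trmxK !tr_kel !mulmx_block !mul0mx !mulmx0 !addr0 !add0r.
by rewrite eY eZ.
Qed.

Lemma estratum_orbit s t ty e : estratum s t ty e ->
  [set actE g e | g in @Kgroup R p q] = estratum s t ty.
Proof.
move=> [v [Y [Z [v0 [YZ ZY] [e1 e2 eT] ->]]]]; apply/seteqP; split=> [_ [g Kg <-]|].
  have [G1 [G2 [u1 u2 ->]]] := KgroupP Kg.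
  have f1 : row_free G1 by rewrite row_free_unit.
  have f2 : row_free G2 by rewrite row_free_unit.
  have f1' : row_full (invmx G1) by rewrite row_full_unit unitmx_inv.
  have f2' : row_full (invmx G2) by rewrite row_full_unit unitmx_inv.
  exists (v *m G1), (invmx G1 *m Y *m G2), (invmx G2 *m Z *m G1); split.
  - by rewrite mulmx_free_eq0.
  - rewrite -!mulmxA [G2 *m _]mulmxA [G1 *m (_ *m (_ *m _))]mulmxA !mulmxV // !mul1mx.
    by rewrite [Y *m _]mulmxA [Z *m _]mulmxA YZ ZY !mul0mx !mulmx0.
  - split; first by rewrite mxrankMfree // eqmxMfull.
      by rewrite mxrankMfree // eqmxMfull.
    rewrite -eT /etype submxMfree // (eqmxMfull Z) //.
    by rewrite !mulmxA mulmxK // mulmx_free_eq0.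
  by apply: act_ept; rewrite // -!mulmxA mulKVmx.
move=> _ [v' [Y' [Z' [v0' [YZ' ZY'] [d1 d2 dT] ->]]]].
(* [etype] determines both conditions, since Z Y = 0 forces v Y = 0 as soon as v is in the row space
   of [Z]. *)
have [c1 c2] : (v <= Z)%MS = (v' <= Z')%MS /\ (v *m Y == 0) = (v' *m Y' == 0).
  have vz (w : 'rV[C]_p) U W : W *m U = 0 -> (w <= W)%MS -> w *m U == 0.
    by move=> WU /submxP[D ->]; rewrite -mulmxA WU mulmx0.
  move: (vz _ _ v Y Z ZY) (vz _ _ v' Y' Z' ZY') (etrans eT (esym dT)); rewrite /etype.
  case: (v <= Z)%MS; case: (v' <= Z')%MS; case: (v *m Y == 0);
    case: (v' *m Y' == 0) => h1 h2 h3; split=> //; 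
    by [discriminate h3|have := h1 isT|have := h2 isT].
have [G1 [G2 [[u1 u2] [h1 h2 h3]]]] := exotic_nilcone_classification YZ ZY YZ' ZY'
  v0 v0' (etrans e2 (esym d2)) (etrans e1 (esym d1)) c1 c2.
exists (kel G1 G2); first exact: kel_Kgroup.
by rewrite (act_ept v u1 u2 h1 h2) h3.
Qed.

Lemma estratum_inj s t ty s' t' ty' e :
    estratum s t ty e -> estratum s' t' ty' e ->
  [/\ s = s', t = t' & ty = ty'].
Proof.
move=> [v [Y [Z [v0 [YZ ZY] [<- <- <-] ->]]]].
move=> [v' [Y' [Z' [v0' [YZ' ZY'] [<- <- <-]]]]].
case=> /sp_line_eq ev /trmx_inj/eq_block_mx[_ -> -> _]; split=> //.
exact: etype_eqmx.
Qed.

End Orbits.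

(** * Zariski closed sets *)

Section Topology.
Variables (R : realType) (p q k : nat).
Local Notation C := (R[i]).
Local Notation n := (p + q)%N.
Local Notation N := (n * k + p + n * n)%N.

Definition ypt (A : 'M[C]_(k, n)) (v : 'rV[C]_p) (X : 'M[C]_n) : Ypt R p q :=
  (sp A, sp (row_mx v 0), X^T).

Lemma yptE (A : 'M[C]_(n, k)) (v : 'cV[C]_p) (x : 'M[C]_n) :
  (limg (lmul A), <[col_mx v (0 : 'cV_q)]>%VS, x) = ypt A^T v^T x^T.
Proof. by rewrite /ypt /sp !trmxK -{1}[v]trmxK vline_sp. Qed.

Lemma ypt_Gr A v X : row_free A -> v != 0 ->
  (@Gr R p q k `*` @PV1 R p q `*` setT) (ypt A v X).
Proof.
move=> fA v0; split=> //; split=> /=; last by apply/PV1P; exists v.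
by rewrite /Gr /= dim_sp; apply/eqP.
Qed.

Lemma ypt_eq A v X A' v' X' : v != 0 -> ypt A v X = ypt A' v' X' ->
  exists E c, [/\ E \in unitmx, c != 0, A' = E *m A, v' = c *: v & X' = X].
Proof.
move=> v0 [/sp_eqP eA /sp_line_eq ev /trmx_inj eX].
have /eqmxMunitP[E Eu ->] : (A' == A)%MS by apply/eqmxP/eqmx_sym.
have /sub_rVP[c ec] : (v' <= v)%MS by rewrite ev.
exists E, c; split=> //; apply: contraNneq v0 => c0.
by rewrite -submx0 ev ec c0 scale0r sub0mx.
Qed.

Lemma horner_mmap N' (h : 'I_N' -> {poly C}) (f : mpoly.mpoly N' C) t :
  (mpoly.mmap polyC h f).[t] = mpoly.meval (fun i => (h i).[t]) f.
Proof.
rewrite mpoly.mevalE /mpoly.mmap horner_sum; apply: eq_bigr => m _.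
rewrite hornerM hornerC /mpoly.mmap1 horner_prod; congr (_ * _).
by apply: eq_bigr => i _; rewrite horner_exp.
Qed.

Lemma coords_line (A : 'M[C]_(n, k)) (v : 'cV[C]_p) (x d : 'M[C]_n) t i :
  coords A v (x + t *: d) i = coords A v x i + t * coords 0 0 d i.
Proof.
rewrite /coords -[RHS]/(_ + t * (row_mx (row_mx (mxvec 0) 0^T) (mxvec d)) 0 i).
set M := row_mx _ (mxvec x); set D := row_mx _ (mxvec d).
suff -> : row_mx (row_mx (mxvec A) v^T) (mxvec (x + t *: d)) = M + t *: D.
  by rewrite !mxE.
rewrite /M /D !scale_row_mx !add_row_mx linearD linearZ /=.
by rewrite linear0 trmx0 !scaler0 !addr0.
Qed.

(** Along the line an equation [f] of [Z] becomes a polynomial in t whose product with [g] vanishes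
    everywhere; hence it vanishes at t = 0 too. *)
Lemma zclosed_line (Z : set (Ypt R p q)) A v X D :
    @zclosed R p q k Z -> row_free A -> v != 0 ->
    cofinite (fun t => Z (ypt A v (X + t *: D))) ->
  Z (ypt A v X).
Proof.
move=> [_ [F ZF]] fA v0 [g g0 gZ].
have rA : \rank A^T = k by rewrite mxrank_tr; apply/eqP.
have v0' : v^T != 0 by rewrite -mxrank_eq0 mxrank_tr mxrank_eq0.
have ZP x : Z (ypt A v x) <-> forall f, F f -> mpoly.meval (coords A^T v^T x^T) f = 0.
  by rewrite -(ZF A^T v^T x^T rA v0') yptE !trmxK.
apply/ZP => f Ff.
pose h i := (coords A^T v^T X^T i)%:P + 'X * (coords 0 0 D^T i)%:P.
have hE t : (mpoly.mmap polyC h f).[t] = mpoly.meval (coords A^T v^T (X + t *: D)^T) f.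
  rewrite horner_mmap; apply: mpoly.meval_eq => i.
  by rewrite linearD linearZ /= coords_line /h !hornerE.
have : mpoly.mmap polyC h f * g = 0.
  apply: poly_vanishing => t; rewrite hornerM hE.
  have [->|/gZ/ZP/(_ f Ff)->] := eqVneq g.[t] 0; first by rewrite mulr0.
  by rewrite mul0r.
move/eqP; rewrite mulf_eq0 (negPf g0) orbF => /eqP h0.
by have := hE 0; rewrite h0 horner0 scale0r addr0.
Qed.

Definition MP : comNzRingType := mpoly.mpoly N (C : comNzRingType).
Definition mC (c : C) : MP := @mpoly.mpolyC N C c.
Definition Xpol (i : 'I_N) : MP := mpoly.mpolyX C (mpoly.mnm1 i).
Definition ev (c : 'I_N -> C) : {rmorphism MP -> C} := mpoly.meval c.

Lemma evX c i : ev c (Xpol i) = c i. Proof. exact: mpoly.mevalXU. Qed.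
Lemma evC c x : ev c (mC x) = x. Proof. exact: mpoly.mevalC. Qed.

Definition Apol : 'M[MP]_(k, n) :=
  \matrix_(j, i) Xpol (lshift (n * n) (lshift p (mxvec_index i j))).
Definition vpol : 'rV[MP]_p :=
  \row_i Xpol (lshift (n * n) (rshift (n * k) i)).
Definition Xmpol : 'M[MP]_n :=
  \matrix_(j, i) Xpol (rshift (n * k + p) (mxvec_index i j)).

Lemma meval_pol A v X (m := ev (coords A^T v^T X^T)) :
  [/\ map_mx m Apol = A, map_mx m vpol = v & map_mx m Xmpol = X].
Proof.
split; apply/matrixP=> i j; rewrite !mxE /m evX /coords.
- by rewrite !row_mxEl mxvecE mxE.
- by rewrite row_mxEl row_mxEr trmxK ord1.
- by rewrite row_mxEr mxvecE mxE.
Qed.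

Variables (a b : nat).
Variable M : forall S : comNzRingType,
  'M[S]_(k, n) -> 'rV[S]_p -> 'M[S]_n -> 'M[S]_(a, b).
Hypothesis M_natural : forall (S S' : comNzRingType) (f : {rmorphism S -> S'}) A v X,
  map_mx f (M A v X) = M (map_mx f A) (map_mx f v) (map_mx f X).

(* Quantifying over all presentations (A, v, X) of a point makes the condition
   independent of the presentation, whatever M is. *)
Definition rank_locus (c : nat) : set (Ypt R p q) :=
  [set y | (@Gr R p q k `*` @PV1 R p q `*` setT) y /\
    forall A v X, row_free A -> v != 0 -> y = ypt A v X ->
      (\rank (M A v X) <= c)%N].

(** [M] is one formula over all commutative rings, so it can be formed on matrices of indeterminates
    and commutes with evaluation. The equations are its compressed determinants, for all changes of
    presentation [E], [e]. *)
Lemma zclosed_rank_locus c : @zclosed R p q k (rank_locus c).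
Proof.
split; first by move=> y [].
exists [set f | exists (U : 'M_(c.+1, a)) (V : 'M_(b, c.+1)) (E : 'M_k) (e : C),
  [/\ E \in unitmx, e != 0 & f = \det (map_mx mC U *m
    M (map_mx mC E *m Apol) (mC e *: vpol) Xmpol *m map_mx mC V)]].
move=> A v x rA v0; rewrite yptE.
have fA : row_free A^T by rewrite /row_free mxrank_tr rA.
have v0' : v^T != 0 by rewrite -mxrank_eq0 mxrank_tr mxrank_eq0.
have [mA mv mX] := meval_pol A^T v^T x^T; rewrite !trmxK in mA mv mX.
have mE (U : 'M_(c.+1, a)) (V : 'M_(b, c.+1)) (E : 'M_k) (e : C) :
  ev (coords A v x) (\det (map_mx mC U *m
    M (map_mx mC E *m Apol) (mC e *: vpol) Xmpol *m map_mx mC V)) =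
  \det (U *m M (E *m A^T) (e *: v^T) x^T *m V).
  have mK r s (B : 'M[C]_(r, s)) : map_mx (ev (coords A v x)) (map_mx mC B) = B.
    by apply/matrixP=> i j; rewrite !mxE evC.
  rewrite -det_map_mx !map_mxM /= M_natural map_mxM map_mxZ /= !mK mA mv mX.
  by rewrite evC.
split=> [[_ H] f [U [V [E [e [Eu e0 ->]]]]]|H].
  rewrite -[LHS]/(ev _ _) mE; apply: ((rank_leP _ _).1 _); apply: H.
  - by rewrite /row_free (eqmxMfull A^T) ?row_full_unit.
  - by rewrite scaler_eq0 negb_or e0.
  rewrite /ypt; congr (_, _, _).
    by apply/sp_eqP/eqmx_sym/eqmxMfull; rewrite row_full_unit.
  by apply/sp_line_eq/eqmx_sym/eqmx_scale.
split; first exact: ypt_Gr.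
move=> B w X fB w0 /(ypt_eq v0')[E [e [Eu e0 -> -> ->]]].
apply/rank_leP=> U V; rewrite -mE; apply: H.
by exists U, V, E, e.
Qed.

Lemma zclosure_rank (S : set (Ypt R p q)) c : S `<=` rank_locus c ->
  forall A v X, row_free A -> v != 0 -> @zclosure R p q k S (ypt A v X) ->
  (\rank (M A v X) <= c)%N.
Proof.
move=> Sc A v X fA v0 /(_ (rank_locus c)); case; last by move=> _; apply.
by split=> //; apply: zclosed_rank_locus.
Qed.

End Topology.

(** * The orbit attached to a conormal bundle *)

Section Main.
Variables (R : realType) (p q k : nat).
Local Notation C := (R[i]).
Local Notation n := (p + q)%N.

Lemma conormal_ypt (A : 'M[C]_(k, n)) v X : row_free A -> v != 0 ->
  @conormal_variety R p q k (ypt A v X) <-> conormal (lsubmx A) (rsubmx A) v X.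
Proof.
move=> fA v0; rewrite /conormal_variety /ypt /conormal hsubmxK /=.
have eX : limg (lmul X^T) = sp X by [].
have eT : limg (lmul (theta X^T)) = sp (block_mx (ulsubmx X) 0 0 (drsubmx X)).
  by rewrite theta_tr.
have thE : (sp (block_mx (ulsubmx X) 0 0 (drsubmx X)) <= sp (row_mx v 0))%VS <->
    (ulsubmx X <= v)%MS /\ drsubmx X = 0.
  rewrite sp_sub block_mxEv col_mx_sub; split.
    case/andP=> /submxP[D]; rewrite mul_mx_row mulmx0 => /eq_row_mx[-> _].
    by case/submxP=> E; rewrite mul_mx_row mulmx0 => /eq_row_mx[_ ->]; rewrite submxMl.
  move=> [/submxP[D ->] ->]; rewrite row_mx0 sub0mx andbT; apply/submxP.
  by exists D; rewrite mul_mx_row mulmx0.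
have kerE : (sp (row_mx v 0) <= lker (lmul (theta X^T)))%VS <-> v *m ulsubmx X = 0.
  rewrite theta_tr sp_ker mul_row_block !mulmx0 mul0mx !addr0.
  split=> [|->]; last by rewrite row_mx0.
  by rewrite -row_mx0 => /eq_row_mx[].
rewrite eX eT sp_sub; split.
  by move=> [_ _ [XA /sp_ker AX] [/thE[Xv X2] /kerE vX]]; split.
move=> [X2 Xv vX AX XA]; split.
- by rewrite /Gr /= dim_sp; apply/eqP.
- by apply/PV1P; exists v.
- by split=> //; apply/sp_ker.
- by split; [apply/thE|apply/kerE].
Qed.

Lemma conormal_bundleP r1 r2 T y :
  @conormal_bundle R p q k (xstratum k r1 r2 T) y <->
  exists (A : 'M[C]_(k, n)) v X, [/\ row_free A, v != 0, conormal (lsubmx A) (rsubmx A) v X,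
    [/\ \rank (lsubmx A) = r1, \rank (rsubmx A) = r2 &
        xtype (lsubmx A) (rsubmx A) v = T] & y = ypt A v X].
Proof.
split=> [[cy Oy]|[A [v [X [fA v0 cX inv ->]]]]]; last first.
  split; first exact/conormal_ypt.
  by exists (lsubmx A), (rsubmx A), v; rewrite /xpt hsubmxK; split.
case: y cy Oy => -[W L] x cy [A1 [A2 [v [fA v0 inv /= [eW eL]]]]].
exists (row_mx A1 A2), v, x^T; rewrite /ypt row_mxKl row_mxKr trmxK -eW -eL.
split=> //; move: cy; rewrite eW eL -[x]trmxK.
by move/conormal_ypt; rewrite row_mxKl row_mxKr trmxK; apply.
Qed.

Lemma pi_preimageP s t ty (A : 'M[C]_(k, n)) v X : row_free A -> v != 0 ->
  @pi_preimage R p q k (estratum s t ty) (ypt A v X) <->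
  conormal (lsubmx A) (rsubmx A) v X /\
  [/\ \rank (dlsubmx X) = s, \rank (ursubmx X) = t &
      etype (ursubmx X) (dlsubmx X) v = ty].
Proof.
move=> fA v0; have -> : pi_preimage k (estratum s t ty) (ypt A v X) =
    (@conormal_variety R p q k (ypt A v X) /\
     estratum s t ty (ept v (ursubmx X) (dlsubmx X))).
  by rewrite /pi_preimage /setI /preimage /= mtheta_tr.
have block : conormal (lsubmx A) (rsubmx A) v X ->
    conormal (lsubmx A) (rsubmx A) v
      (block_mx (ulsubmx X) (ursubmx X) (dlsubmx X) 0).
  by move=> cX; case: (cX) => <- _ _ _ _; rewrite submxK.
split=> [[/conormal_ypt cX eO]|[cX inv]].
  split; first exact: cX.
  have [YZ ZY] := conormal_nil (block (cX fA v0)).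
  have eO' : estratum (\rank (dlsubmx X)) (\rank (ursubmx X))
     (etype (ursubmx X) (dlsubmx X) v) (ept v (ursubmx X) (dlsubmx X)).
    by exists v, (ursubmx X), (dlsubmx X).
  exact: estratum_inj eO' eO.
split; first exact/conormal_ypt.
have [YZ ZY] := conormal_nil (block cX).
by exists v, (ursubmx X), (dlsubmx X).
Qed.

(** Every clause bounds the rank of a matrix given by a formula natural in the ring, under premises
    on fixed integers only; [close] therefore passes each one to the closure. *)
Lemma stratum_bounds_closure s t ty (A : 'M[C]_(k, n)) v X : row_free A -> v != 0 ->
    @zclosure R p q k (pi_preimage k (estratum s t ty)) (ypt A v X) ->
  stratum_bounds s t ty (lsubmx A) (rsubmx A) v X.
Proof.
move=> fA v0 yS.
have inS (B : 'M[C]_(k, n)) w X' : row_free B -> w != 0 ->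
    pi_preimage k (estratum s t ty) (ypt B w X') ->
    stratum_bounds s t ty (lsubmx B) (rsubmx B) w X'.
  move=> fB w0 /(pi_preimageP s t ty X' fB w0)[cX [<- <- <-]].
  have [dr _ _ _ _] := cX; rewrite -[X' in stratum_bounds _ _ _ _ _ _ X']submxK dr.
  apply: stratum_boundsP => //; first by rewrite hsubmxK.
  by rewrite -dr submxK.
have close a b (f : forall S : comNzRingType,
    'M[S]_(k, n) -> 'rV[S]_p -> 'M[S]_n -> 'M[S]_(a, b)) c :
    (forall (S S' : comNzRingType) (g : {rmorphism S -> S'}) A v X,
       map_mx g (f S A v X) = f S' (map_mx g A) (map_mx g v) (map_mx g X)) ->
    (forall (B : 'M[C]_(k, n)) w X', stratum_bounds s t ty (lsubmx B) (rsubmx B) w X' ->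
       (\rank (f _ B w X') <= c)%N) ->
    (\rank (f _ A v X) <= c)%N.
  move=> fnat fS; apply: (zclosure_rank fnat _ fA v0 yS) => y Sy; split.
    case: y Sy => -[W L] x [[/= Wk PL _ _] _]; by split.
  by move=> B w X' fB w0 ey; apply/fS/inS; rewrite -?ey.
rewrite /stratum_bounds /=; do ![split].
- refine (close _ _ (fun S B w U => dlsubmx U) _ _ _).
    by move=> *; rewrite map_dlsubmx.
  by move=> B w U [c1 [c2 [c3 [c4 [c5 [c6 [c7 [c8 [c9 [c10 c11]]]]]]]]]]; exact: c1.
- refine (close _ _ (fun S B w U => ursubmx U) _ _ _).
    by move=> *; rewrite map_ursubmx.
  by move=> B w U [c1 [c2 [c3 [c4 [c5 [c6 [c7 [c8 [c9 [c10 c11]]]]]]]]]]; exact: c2.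
- refine (close _ _ (fun S B w U => rsubmx B) _ _ _).
    by move=> *; rewrite map_rsubmx.
  by move=> B w U [c1 [c2 [c3 [c4 [c5 [c6 [c7 [c8 [c9 [c10 c11]]]]]]]]]]; exact: c3.
- refine (close _ _ (fun S B w U => lsubmx B) _ _ _).
    by move=> *; rewrite map_lsubmx.
  by move=> B w U [c1 [c2 [c3 [c4 [c5 [c6 [c7 [c8 [c9 [c10 c11]]]]]]]]]]; exact: c4.
- move=> h; refine (close _ _ (fun S B w U => ulsubmx U) _ _ _).
    by move=> *; rewrite map_ulsubmx.
  by move=> B w U [c1 [c2 [c3 [c4 [c5 [c6 [c7 [c8 [c9 [c10 c11]]]]]]]]]]; exact: c5 h.
- move=> h; refine (close _ _ (fun S B w U =>
    col_mx (row_mx (lsubmx B) (rsubmx B)) (row_mx w 0)) _ _ _).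
    by move=> *; rewrite map_col_mx !map_row_mx map_lsubmx map_rsubmx map_mx0.
  by move=> B w U [c1 [c2 [c3 [c4 [c5 [c6 [c7 [c8 [c9 [c10 c11]]]]]]]]]]; exact: c6 h.
- move=> h; refine (close _ _ (fun S B w U => col_mx (dlsubmx U) w) _ _ _).
    by move=> *; rewrite map_col_mx map_dlsubmx.
  by move=> B w U [c1 [c2 [c3 [c4 [c5 [c6 [c7 [c8 [c9 [c10 c11]]]]]]]]]]; exact: c7 h.
- move=> h; refine (close _ _ (fun S B w U => w *m ursubmx U) _ _ _).
    by move=> *; rewrite map_mxM map_ursubmx.
  by move=> B w U [c1 [c2 [c3 [c4 [c5 [c6 [c7 [c8 [c9 [c10 c11]]]]]]]]]]; exact: c8 h.
- move=> h; refine (close _ _ (fun S B w U => lsubmx B *m ulsubmx U) _ _ _).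
    by move=> *; rewrite map_mxM map_lsubmx map_ulsubmx.
  by move=> B w U [c1 [c2 [c3 [c4 [c5 [c6 [c7 [c8 [c9 [c10 c11]]]]]]]]]]; exact: c9 h.
- move=> h; refine (close _ _ (fun S B w U => col_mx (lsubmx B) w) _ _ _).
    by move=> *; rewrite map_col_mx map_lsubmx.
  by move=> B w U [c1 [c2 [c3 [c4 [c5 [c6 [c7 [c8 [c9 [c10 c11]]]]]]]]]]; exact: c10 h.
- move=> h; refine (close _ _ (fun S B w U => row_mx (ulsubmx U) (ursubmx U)) _ _ _).
    by move=> *; rewrite map_row_mx map_ulsubmx map_ursubmx.
  by move=> B w U [c1 [c2 [c3 [c4 [c5 [c6 [c7 [c8 [c9 [c10 c11]]]]]]]]]]; exact: c11 h.
Qed.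

Lemma conormal_closure r1 r2 T s t ty : phi p q k r1 r2 T = (s, t, ty) ->
  @conormal_bundle R p q k (xstratum k r1 r2 T) `<=`
  zclosure k (pi_preimage k (estratum s t ty)).
Proof.
move=> ephi y /conormal_bundleP[A [v [X [fA v0 cX [e1 e2 eT] ->]]]] Z [Zc SZ].
have fA' : row_free (row_mx (lsubmx A) (rsubmx A)) by rewrite hsubmxK.
have [oG [X0 cX0 gX0]] := opendense_generic fA' v0.
(* The line joins [X] at t = 0 to the generic vector [X0] at t = 1. *)
apply: (zclosed_line Zc fA v0 (D := X0 - X)).
have [g g0 gP] : cofinite (fun t => generic (lsubmx A) (rsubmx A) v (X + t *: (X0 - X))).
  by apply: (oG _ _ 1); rewrite scale1r addrC subrK.
exists g => // x /gP gx; apply/SZ/pi_preimageP => //.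
have cx := conormal_line x cX cX0; split=> //.
move: cx gx; set X' := X + _ => cx gx; have [dr _ _ _ _] := cx.
rewrite -[X']submxK dr in cx gx.
have := generic_invariants fA' v0 cx gx.
by rewrite e1 e2 eT ephi => -[-> -> ->].
Qed.

Lemma conormal_closure_unique r1 r2 T s t ty : x_admissible p q k r1 r2 T ->
    nil_admissible p q k s t ty ->
    @conormal_bundle R p q k (xstratum k r1 r2 T) `<=`
      zclosure k (pi_preimage k (estratum s t ty)) ->
  phi p q k r1 r2 T = (s, t, ty).
Proof.
move=> xadm nadm sub.
have [A1 [A2 [v [fA v0 [e1 e2 eT]]]]] := exists_xtype C xadm.
have [_ [X cX gX]] := opendense_generic fA v0.
have [dr _ _ _ _] := cX.
have cX' := cX; have gX' := gX; rewrite -[X]submxK dr in cX' gX'.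
have : zclosure k (pi_preimage k (estratum s t ty)) (ypt (row_mx A1 A2) v X).
  apply: sub; apply/conormal_bundleP; exists (row_mx A1 A2), v, X.
  by rewrite row_mxKl row_mxKr.
move/(stratum_bounds_closure fA v0); rewrite row_mxKl row_mxKr.
rewrite -[X]submxK dr => bnd; rewrite -e1 -e2 -eT.
exact: esym (generic_stratum fA v0 cX' gX' nadm bnd).
Qed.

Lemma estratum_nonempty r1 r2 T s t ty : x_admissible p q k r1 r2 T ->
    phi p q k r1 r2 T = (s, t, ty) ->
  nil_admissible p q k s t ty /\ exists e, @estratum R p q s t ty e.
Proof.
move=> xadm ephi; have [A1 [A2 [v [fA v0 [e1 e2 eT]]]]] := exists_xtype C xadm.
have [_ [X cX gX]] := opendense_generic fA v0.
have [dr _ _ _ _] := cX; rewrite -[X]submxK dr in cX gX.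
have := generic_invariants fA v0 cX gX; rewrite e1 e2 eT ephi => -[<- <- <-].
split; first exact (conormal_nil_admissible fA v0 cX).
exists (ept v (ursubmx X) (dlsubmx X)), v, (ursubmx X), (dlsubmx X); split=> //.
exact: conormal_nil cX.
Qed.

(** Nonemptiness stays a separate condition: for a stratum in the image of [phi] it comes from a
    generic conormal vector, by [estratum_nonempty]. *)
Lemma orbitsEP (O : set (Ept R p q)) : orbitsE R p q k O <->
  exists s t ty, [/\ nil_admissible p q k s t ty, exists e, O e &
    O = estratum s t ty].
Proof.
split=> [[e /exotic_nilconeP[v [Y [Z [v0 [YZ ZY] rk ee]]]] ->]|].
  have eS : estratum (\rank Z) (\rank Y) (etype Y Z v) e by exists v, Y, Z.
  exists (\rank Z), (\rank Y), (etype Y Z v); rewrite (estratum_orbit eS).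
  by split=> //; [exact: etype_nil_admissible|exists e].
move=> [s [t [ty [adm [e Oe] eO]]]]; exists e; last first.
  by rewrite eO; apply/esym/estratum_orbit; rewrite -eO.
move: Oe; rewrite eO => -[v [Y [Z [v0 nil [eZ eY _] ->]]]].
apply/exotic_nilconeP; exists v, Y, Z; split=> //.
by case: adm; rewrite eZ eY.
Qed.

Lemma PhiE r1 r2 T s t ty : x_admissible p q k r1 r2 T ->
  phi p q k r1 r2 T = (s, t, ty) ->
  Phi R p q k (xstratum k r1 r2 T) = estratum s t ty.
Proof.
move=> xadm ephi; rewrite /Phi /orbit_of_component.
(* A closed set containing S contains its closure, so the inclusion need only be tested on the
   bundle itself. *)
have subE S (O : set (Xpt R p q)) :
    zclosure k (conormal_bundle k O) `<=` zclosure k S <->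
    conormal_bundle k O `<=` zclosure k S.
  split=> [H y Oy|H y Hy Z [Zc SZ]]; first by apply: H => Z [_]; apply.
  by apply: Hy; split=> // z /H; apply.
have [nadm ex] := estratum_nonempty xadm ephi.
have uniq : unique (fun O' => orbitsE R p q k O' /\
    zclosure k (conormal_bundle k (xstratum k r1 r2 T)) `<=`
    zclosure k (pi_preimage k O')) (estratum s t ty).
  split.
    split; first by apply/orbitsEP; exists s, t, ty.
    by apply/subE; apply: conormal_closure.
  move=> O' [/orbitsEP[s' [t' [ty' [nadm' _ ->]]]] /subE H].
  by have := conormal_closure_unique xadm nadm' H; rewrite ephi => -[-> -> ->].
by apply: xget_unique => // O' [_ uO']; apply: uO'; case: uniq.
Qed.

End Main.

Theorem corollary1p8 (R : realType) (p q k : nat)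
    (hn : (0 < p + q)%N) (hk : (k <= p + q)%N) :
  ([/\ set_fun (orbitsX R p q k) (orbitsE R p q k) (Phi R p q k),
       set_surj (orbitsX R p q k) (orbitsE R p q k) (Phi R p q k) &
       forall O : set (Ept R p q), orbitsE R p q k O ->
         ((orbitsX R p q k `&` Phi R p q k @^-1` [set O])%classic
            #<= `I_2)%card])
  /\
  ((p <= maxn k (maxn (p + q - k) q.+1))%N ->
     set_bij (orbitsX R p q k) (orbitsE R p q k) (Phi R p q k)).
Proof.
have PhiS r1 r2 T : x_admissible p q k r1 r2 T -> exists s t ty,
    phi p q k r1 r2 T = (s, t, ty) /\
    Phi R p q k (xstratum k r1 r2 T) = estratum s t ty.
  case e: (phi p q k r1 r2 T) => [[s t] ty] adm; exists s, t, ty.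
  by split; last exact: PhiE.
have Phi_inj r1 r2 T r1' r2' T' :
    x_admissible p q k r1 r2 T -> x_admissible p q k r1' r2' T' ->
    Phi R p q k (xstratum k r1 r2 T) = Phi R p q k (xstratum k r1' r2' T') ->
    phi p q k r1 r2 T = phi p q k r1' r2' T'.
  move=> adm adm'; have [s [t [ty [e ->]]]] := PhiS _ _ _ adm.
  have [s' [t' [ty' [e' ->]]]] := PhiS _ _ _ adm'.
  (* Equal strata have equal parameters only through a common point. *)
  have [_ [x sx]] := estratum_nonempty R adm e => eS.
  have sx' := sx; rewrite eS in sx'.
  by rewrite e e'; have [-> -> ->] := estratum_inj sx sx'.
have funP : set_fun (orbitsX R p q k) (orbitsE R p q k) (Phi R p q k).
  move=> O /orbitsXP[r1 [r2 [T [adm ->]]]].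
  have [s [t [ty [e ->]]]] := PhiS _ _ _ adm.
  have [nadm ex] := estratum_nonempty R adm e.
  by apply/orbitsEP; exists s, t, ty.
have surjP : set_surj (orbitsX R p q k) (orbitsE R p q k) (Phi R p q k).
  move=> O /orbitsEP[s [t [ty [nadm _ ->]]]].
  have [r1 [r2 [T [adm e]]]] := phi_surj hk nadm.
  exists (xstratum k r1 r2 T); last exact: PhiE.
  by apply/orbitsXP; exists r1, r2, T.
split; first split=> // O _.
  pose type1 (O : set (Xpt R p q)) := exists r1 r2,
    x_admissible p q k r1 r2 1 /\ O = xstratum k r1 r2 1.
  have type1E r1 r2 T : x_admissible p q k r1 r2 T ->
      type1 (xstratum k r1 r2 T) <-> T = 1%N.
    move=> adm; split=> [[s1 [s2 [adm' eS]]]|eT]; last by exists r1, r2; rewrite -eT.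
    have [A1 [A2 [v [fA v0 inv]]]] := exists_xtype (complex R) adm.
    have mem : xstratum k r1 r2 T (xpt A1 A2 v) by exists A1, A2, v.
    by have := mem; rewrite eS => /(xstratum_inj mem)[].
  (* By [phi_inj], whether L lies in W separates the orbits in a fiber. *)
  apply/pcard_leP/injfunPex; exists (fun O => if `[< type1 O >] then 0%N else 1%N).
    by move=> O' _ /=; case: ifP.
  move=> O1 O2; rewrite !inE /= => -[/orbitsXP[r1 [r2 [T [adm ->]]]] e1].
  move=> [/orbitsXP[s1 [s2 [T' [adm' ->]]]] e2] ef.
  have eT : (T == 1%N) = (T' == 1%N).
    apply/eqP/eqP => eT.
      apply/(type1E _ _ _ adm'); move/(type1E _ _ _ adm): eT => eT.
      by move: ef; rewrite (asboolT eT); case: asboolP.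
    apply/(type1E _ _ _ adm); move/(type1E _ _ _ adm'): eT => eT.
    by move: ef; rewrite (asboolT eT); case: asboolP.
  have e := Phi_inj _ _ _ _ _ _ adm adm' (etrans e1 (esym e2)).
  by have [-> -> ->] := phi_inj adm adm' e (or_introl eT).
move=> hpq; split=> // O1 O2; rewrite !inE => /orbitsXP[r1 [r2 [T [adm ->]]]].
move=> /orbitsXP[s1 [s2 [T' [adm' ->]]]] /(Phi_inj _ _ _ _ _ _ adm adm') e.
by have [-> -> ->] := phi_inj adm adm' e (or_intror hpq).
Qed.
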